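(* Let $\mathbb{K}$ be a field and let $L$ be a maximal lattice (with respect to $\mathbb{K}$) on $k\ge 1$ atoms with $\operatorname{pdim}_Q L = p$. Then its Scarf complex $\Delta$ is a $(p-1)$-dimensional stoss complex (with vertex set the set of the $k$ atoms of $L$).
   Context: All lattices are finite, with minimal element $\hat 0$. A lattice is atomistic if every element is a join of atoms. Every finite atomistic lattice $L$ is isomorphic to the lcm lattice $L_I$ of some monomial ideal $I$ in some polynomial ring $S$ over $\mathbb{K}$, where $L_I$ is the lattice of all least common multiples of subsets of the minimal monomial generators of $I$ (ordered by divisibility). $\operatorname{pdim}_Q L$ is the projective dimension of $S/I$ over $S$ for any such $I$; it depends only on $L$ and $\mathbb{K}$. (Equivalently, $\operatorname{pdim}_Q L=\max\{i : \exists m\in L\setminus\{\hat0\},\ \tilde H_{i-2}(\{x\in L:\hat 0<x<m\};\mathbb{K})\ne0\}$, with reduced homology of the order complex, for $L$ with at least two elements.) A finite atomistic lattice $L$ is maximal if every atomistic lattice $L'\not\cong L$ with the same number of atoms that admits a surjective join-preserving map $L'\to L$ satisfies $\operatorname{pdim}_Q L'>\operatorname{pdim}_Q L$. The Scarf complex of an atomistic lattice $L$ is the set of those elements of $L$ which can be written as a join of a set of atoms in a unique way, regarded as a simplicial complex on the atoms of $L$ (an element corresponds to the set of atoms below it). A $d$-dimensional simplicial complex on a vertex set $V$ is a stoss complex if it has a complete $(d-1)$-skeleton (every subset of $V$ with at most $d$ elements is a face) and is $\mathbb{K}$-acyclic (all reduced homology over $\mathbb{K}$ vanishes). *)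

(* Defs.v *)
From HB Require Import structures.
From mathcomp Require Import all_boot all_order all_algebra.
From mathcomp Require Import mpoly.

Set Implicit Arguments.
Unset Strict Implicit.
Unset Printing Implicit Defensive.

Import Order.TTheory GRing.Theory.
Local Open Scope ring_scope.

Definition surj (A B : Type) (f : A -> B) : Prop := forall y, exists x, f x = y.

Definition projective (R : nzRingType) (P : lmodType R) : Prop :=
  forall (M N : lmodType R) (f : {linear M -> N}) (g : {linear P -> N}),
    surj f -> exists h : {linear P -> M}, forall x, f (h x) = g x.

Definition has_proj_resolution (R : nzRingType) (M : lmodType R) (q : nat)
    : Prop :=
  exists (P : nat -> lmodType R) (d : forall i, {linear P i.+1 -> P i})
         (e : {linear P 0%N -> M}),
    [/\ forall i, projective (P i),
        forall i, (q < i)%N -> forall x : P i, x = 0,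
        surj e,
        forall x, e x = 0 <-> exists y, d 0%N y = x
      & forall i x, d i x = 0 <-> exists y, d i.+1 y = x].

Definition proj_dim (R : nzRingType) (M : lmodType R) (q : nat) : Prop :=
  has_proj_resolution M q /\
  forall r, (r < q)%N -> ~ has_proj_resolution M r.

(* A monomial ideal is given by its finite set G of minimal monomial
   generators, i.e. by a finite antichain for divisibility. *)
Definition min_gens n (G : seq 'X_{1..n}) : Prop :=
  uniq G /\ {in G &, forall g h, (g <= h)%MM -> g = h}.

Definition mon_ideal (K : fieldType) n (G : seq 'X_{1..n}) (q : {mpoly K[n]})
    : Prop :=
  exists c : 'X_{1..n} -> {mpoly K[n]}, q = \sum_(g <- G) c g * 'X_[g].

Definition is_quotient (S : comNzRingType) (I : S -> Prop) (M : lmodType S)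
    : Prop :=
  exists pi : {linear S^o -> M}, surj pi /\ forall q : S^o, pi q = 0 <-> I q.

Definition mlcms n (s : seq 'X_{1..n}) : 'X_{1..n} := foldr (@mlcm n) 0%MM s.

Definition in_lcm_lattice n (G : seq 'X_{1..n}) (m : 'X_{1..n}) : Prop :=
  exists s : seq 'X_{1..n}, {subset s <= G} /\ m = mlcms s.

Definition iso_lcm_lattice (d : Order.disp_t) (L : finTBLatticeType d)
    n (G : seq 'X_{1..n}) : Prop :=
  exists f : L -> 'X_{1..n},
    (forall x y, (f x <= f y)%MM = (x <= y)%O) /\
    (forall m, in_lcm_lattice G m <-> exists x, f x = m).

(* For lattices with at least one atom the value
   does not depend on the monomial ideal used to represent L; for the one
   point lattice it would not be determined, as both I = 0 and I = S have it
   as lcm lattice. *)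
Definition pdimQ (K : fieldType) (d : Order.disp_t) (L : finTBLatticeType d)
    (p : nat) : Prop :=
  exists (n : nat) (G : seq 'X_{1..n}) (M : lmodType {mpoly K[n]}),
    [/\ min_gens G, iso_lcm_lattice L G,
        is_quotient (mon_ideal (K := K) G) M & proj_dim M p].

Definition atoms (d : Order.disp_t) (L : finTBLatticeType d) : {set L} :=
  [set a : L | (a != \bot%O) && [forall x : L, (x < a)%O ==> (x == \bot%O)]].

Definition set_join (d : Order.disp_t) (L : finTBLatticeType d)
    (A : {set L}) : L :=
  (\join_(a in A) a)%O.

Definition atomistic (d : Order.disp_t) (L : finTBLatticeType d) : Prop :=
  forall x : L, exists A : {set L}, A \subset atoms L /\ x = set_join A.

Definition lattice_iso (d d' : Order.disp_t) (L : finTBLatticeType d)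
    (L' : finTBLatticeType d') : Prop :=
  exists f : L -> L', bijective f /\ forall x y, (f x <= f y)%O = (x <= y)%O.

(* Surjectivity forces such a map to preserve the bottom element too. *)
Definition join_surjection (d d' : Order.disp_t) (L : finTBLatticeType d)
    (L' : finTBLatticeType d') (f : L -> L') : Prop :=
  surj f /\ forall x y, f (x `|` y)%O = (f x `|` f y)%O.

Definition maximal_lattice (K : fieldType) (d : Order.disp_t)
    (L : finTBLatticeType d) : Prop :=
  atomistic L /\
  forall (d' : Order.disp_t) (L' : finTBLatticeType d'),
    atomistic L' -> ~ lattice_iso L' L -> #|atoms L'| = #|atoms L| ->
    (exists f : L' -> L, join_surjection f) ->
    forall p p', pdimQ K L p -> pdimQ K L' p' -> (p < p')%N.

Definition simplicial_complex (T : finType) (V : {set T}) (D : {set {set T}})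
    : Prop :=
  [/\ set0 \in D, forall F, F \in D -> F \subset V
    & forall F G : {set T}, F \in D -> G \subset F -> G \in D].

Definition sc_dim (T : finType) (D : {set {set T}}) : int :=
  (\max_(F in D) #|F|)%N%:Z - 1.

(* c is a chain of the augmented simplicial chain complex of D in homological
   degree n - 1, i.e. on the faces with n vertices. *)
Definition chain (K : fieldType) (T : finType) (D : {set {set T}}) (n : nat)
    (c : {ffun {set T} -> K}) : Prop :=
  forall F, c F != 0 -> F \in D /\ #|F| = n.

(* Boundary map, for the orientations given by the enumeration of T: the
   vertex v of v |: F comes with the sign (-1)^j where j is the number of
   vertices of F before v. *)
Definition boundary (K : fieldType) (T : finType) (c : {ffun {set T} -> K})
    : {ffun {set T} -> K} :=
  [ffun F : {set T} => \sum_(v | v \notin F)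
    (-1) ^+ #|[set u in F | (enum_rank u < enum_rank v)%N]| * c (v |: F)].

Definition acyclic (K : fieldType) (T : finType) (D : {set {set T}}) : Prop :=
  forall (n : nat) (c : {ffun {set T} -> K}),
    chain D n c -> boundary c = 0 ->
    exists b : {ffun {set T} -> K}, chain D n.+1 b /\ boundary b = c.

Definition stoss_complex (K : fieldType) (T : finType) (d : int)
    (V : {set T}) (D : {set {set T}}) : Prop :=
  [/\ simplicial_complex V D, sc_dim D = d,
      forall F : {set T}, F \subset V -> #|F|%:Z <= d -> F \in D
    & acyclic K D].

Definition scarf_element (d : Order.disp_t) (L : finTBLatticeType d) (x : L)
    : bool :=
  #|[set A : {set L} | (A \subset atoms L) && (set_join A == x)]| == 1%N.

Definition scarf_complex (d : Order.disp_t) (L : finTBLatticeType d)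
    : {set {set L}} :=
  [set [set a in atoms L | (a <= x)%O] | x in [set x : L | scarf_element x]].

(* Main.v *)
(** The closed sets of atoms of an atomistic lattice L, i.e. the sets of atoms
    below an element, form a closure system.  For a closed set m let Gamma_m be
    the complex of the sets of atoms of m whose closure is not m.  The Taylor
    resolution of the ideal computes Tor in multidegree m as the homology of
    Gamma_m, so that pdim L = p is a statement about these homology groups.

    If A is a minimal nonface of the Scarf complex Delta, then A is not closed
    but its proper subsets are, hence adding A to the closed sets gives a
    lattice above L.  Only the homology of Gamma_m for m the closure of A
    changes: a cell is attached along the boundary of A.  As L is maximal, the
    projective dimension has to increase, so A has at least p elements, and if
    it has exactly p then its boundary already bounds in Gamma_m.  Hence Delta
    has a complete (p-2)-skeleton and Gamma_m is acyclic for every closed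
    nonface m.  Filling a cycle of Delta in the full simplex and pushing the
    filling down through these acyclic Gamma_m ends with a filling in Delta. *)
Require Import Defs.
From HB Require Import structures.
From mathcomp Require Import all_boot all_order all_algebra.
From mathcomp Require Import mpoly generic_quotient ring_quotient.
From Stdlib Require Import Classical ClassicalEpsilon.

Set Implicit Arguments.
Unset Strict Implicit.
Unset Printing Implicit Defensive.

Import Order.TTheory GRing.Theory.
Local Open Scope ring_scope.

(** * Simplicial chains *)

(** Tor is never formed. Projective dimension is defined through arbitrary projective resolutions,
    so its translation into homology of Gamma is proved in both directions. A resolution of length q
    gives a contraction of the Taylor complex in degrees above q; reduced modulo the variables, it
    yields exactness of every Gamma_m on faces with n >= q vertices. Conversely, vanishing on faces
    with q vertices alone has to produce a resolution of length q. Minimal resolutions are avoided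
    here: the cycles in degree q are split off the Taylor module by a projector compatible with
    multidegrees, and the complement ends the resolution.

    Maximality only speaks about lattices for which a value of [pdimQ] is exhibited. The lattice
    obtained by adding A must therefore be realized by an explicit monomial ideal together with an
    actual quotient module. *)

Lemma ffun_sum_delta (R : nzRingType) (I : finType) (x : {ffun I -> R^o}) :
  x = \sum_i x i *: ([ffun j => (j == i)%:R] : {ffun I -> R^o}).
Proof.
apply/ffunP => j; rewrite sum_ffunE (bigD1 j) //= !ffunE eqxx.
rewrite big1 ?addr0 => [|i /negPf ij]; first by rewrite /GRing.scale /= mulr1.
by rewrite !ffunE eq_sym ij scaler0.
Qed.

Section Chains.
Variables (K : fieldType) (T : finType).
Local Notation C := {ffun {set T} -> K^o}.

Definition sgn (A : {set T}) (v : T) : K :=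
  (-1) ^+ #|[set u in A | (enum_rank u < enum_rank v)%N]|.

Definition bd (c : C) : C :=
  [ffun F : {set T} => \sum_(v | v \notin F) sgn F v * c (v |: F)].

Lemma bd_is_linear : linear bd.
Proof.
move=> a c b; apply/ffunP => F; rewrite !ffunE scaler_sumr -big_split /=.
apply: eq_bigr => v _; rewrite !ffunE mulrDr; congr (_ + _).
by rewrite /GRing.scale /= mulrCA.
Qed.
HB.instance Definition _ := GRing.isLinear.Build K C C *:%R bd bd_is_linear.

Lemma sgnU (A : {set T}) u v : v \notin A ->
  sgn (v |: A) u = (-1) ^+ (enum_rank v < enum_rank u)%N * sgn A u.
Proof.
move=> vA; rewrite /sgn -exprD; congr (_ ^+ _).
case lt_vu: (_ < _)%N => /=.
  have -> : [set x in v |: A | (enum_rank x < enum_rank u)%N] =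
    v |: [set x in A | (enum_rank x < enum_rank u)%N].
    by apply/setP => x; rewrite !inE; case: eqP => [->|//]; rewrite lt_vu.
  by rewrite cardsU1 inE (negPf vA).
rewrite add0n; apply: eq_card => x; rewrite !inE; case: eqP => [->|//].
by rewrite lt_vu !andbF.
Qed.

Lemma sgn_swap (A : {set T}) u v : u \notin A -> v \notin A -> u != v ->
  sgn A v * sgn (v |: A) u = - (sgn A u * sgn (u |: A) v).
Proof.
move=> uA vA uv; rewrite !sgnU // mulrCA [sgn A u * _]mulrCA [sgn A u * _]mulrC.
have : (enum_rank u : nat) != enum_rank v.
  by apply: contra uv => /eqP/val_inj/enum_rank_inj ->.
by case: ltngtP => //= _ _; rewrite ?expr0 ?expr1 ?mul1r ?mulN1r ?opprK.
Qed.

Lemma sgn_sq (A : {set T}) v : sgn A v * sgn A v = 1.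
Proof. by rewrite /sgn -exprD addnn -mul2n exprM sqrrN !expr1n. Qed.

Lemma sgn_swap2 (A : {set T}) u v : u \notin A -> v \notin A -> u != v ->
  sgn (u |: A) v * sgn (v |: A) u = - (sgn A u * sgn A v).
Proof.
move=> uA vA uv.
have := congr1 (fun x => sgn A v * x * sgn (u |: A) v) (sgn_swap uA vA uv).
rewrite !mulrA sgn_sq mul1r mulrC => ->.
by rewrite mulrN mulNr -!mulrA sgn_sq mulr1 [sgn A v * _]mulrC.
Qed.

Lemma sgn_neq0 (A : {set T}) v : sgn A v != 0.
Proof. by rewrite /sgn expf_neq0 // oppr_eq0 oner_eq0. Qed.

(** The pairs with u before v are matched with those with v before u; deducing that twice the sum
    vanishes would not settle characteristic 2. *)
Lemma antisym_sum0 (P : pred T) (X : T -> T -> K) :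
    (forall u v, P u -> P v -> u != v -> X u v = - X v u) ->
  \sum_(v | P v) \sum_(u | P u && (u != v)) X v u = 0.
Proof.
move=> antiX.
under eq_bigr => v Pv do
  rewrite (bigID (fun u : T => enum_rank u < enum_rank v)%N) /=.
rewrite big_split /=; apply/eqP; rewrite addr_eq0; apply/eqP.
rewrite (exchange_big_dep P) /=; last by move=> v u _ /andP[/andP[]].
rewrite -sumrN; apply: eq_bigr => v Pv; rewrite -sumrN.
apply: eq_big => [u|u /andP[Pu /andP[/andP[_ uv] _]]]; last first.
  by apply: antiX; rewrite 1?eq_sym.
case Pu: (P u) => //=; rewrite Pv /= eq_sym -leqNgt.
have [->//|uv] := eqVneq v u.
rewrite /= ltn_neqAle; case: eqP => // /val_inj/enum_rank_inj vu.
by rewrite vu eqxx in uv.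
Qed.

Lemma bd_bd (c : C) : bd (bd c) = 0.
Proof.
apply/ffunP => F; rewrite !ffunE.
pose X v u := sgn F v * (sgn (v |: F) u * c (u |: (v |: F))).
rewrite -[RHS](@antisym_sum0 [pred v | v \notin F] X) /=; last first.
  move=> u v uF vF uv; rewrite /X !mulrA sgn_swap // 1?eq_sym // mulNr.
  by rewrite setUCA.
apply: eq_bigr => v vF; rewrite ffunE mulr_sumr; apply: eq_bigl => u.
by rewrite !inE negb_or andbC.
Qed.

(** Contracting homotopy of the full simplex with apex [a], carrying the sign that [bd] gives to
    [a]. *)
Definition cone (a : T) (c : C) : C :=
  [ffun B : {set T} => if a \in B then sgn (B :\ a) a * c (B :\ a) else 0].

Lemma bd_cone a c : bd (cone a c) + cone a (bd c) = c.
Proof.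
apply/ffunP => F; rewrite !ffunE; case: ifPn => aF; last first.
  rewrite addr0 (bigD1 a) //= ffunE setU11 setU1K // mulrA sgn_sq mul1r.
  rewrite big1 ?addr0 // => v /andP[vF va]; rewrite ffunE ifN ?mulr0 //.
  by rewrite !inE negb_or aF eq_sym va.
set E := F :\ a; have aE : a \notin E by rewrite !inE eqxx.
have FE : F = a |: E by rewrite setD1K.
rewrite [X in _ + _ * X](bigD1 a) //= mulrDr mulrA sgn_sq mul1r -FE addrCA.
rewrite [X in _ + X](_ : _ = 0) ?addr0 // mulr_sumr.
have EF v : (v \notin E) && (v != a) = (v \notin F).
  by rewrite FE !inE negb_or andbC.
rewrite [X in _ + X](eq_bigl _ _ EF) -big_split big1 //= => v vF.
have vE : v \notin E by rewrite !inE (negPf vF) andbF.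
have av : a != v by apply: contraNneq vF => <-.
rewrite ffunE !inE aF orbT (_ : (v |: F) :\ a = v |: E); last first.
  by apply/setP => x; rewrite !inE; case: (eqVneq x a) => // ->; rewrite (negPf av).
by rewrite !mulrA FE sgn_swap2 // mulNr addNr.
Qed.

Definition supp (P : pred {set T}) (c : C) : Prop :=
  forall A, ~~ P A -> c A = 0.

Lemma supp0 P : supp P 0.
Proof. by move=> A _; rewrite ffunE. Qed.

Lemma suppD P c b : supp P c -> supp P b -> supp P (c + b).
Proof. by move=> Pc Pb A nA; rewrite ffunE Pc // Pb // addr0. Qed.

Lemma suppZ P a c : supp P c -> supp P (a *: c).
Proof. by move=> Pc A nA; rewrite ffunE Pc // scaler0. Qed.

Lemma suppN P c : supp P c -> supp P (- c).
Proof. by move=> Pc A nA; rewrite ffunE Pc // oppr0. Qed.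

Lemma suppB P c b : supp P c -> supp P b -> supp P (c - b).
Proof. by move=> Pc Pb; apply: suppD => //; apply: suppN. Qed.

Lemma supp_sum P (I : Type) (r : seq I) (Q : pred I) (F : I -> C) :
  (forall i, Q i -> supp P (F i)) -> supp P (\sum_(i <- r | Q i) F i).
Proof. by move=> PF; elim/big_ind: _ => //; [exact: supp0 | exact: suppD]. Qed.

Lemma supp_sub (P Q : pred {set T}) c : (forall A, P A -> Q A) -> supp P c -> supp Q c.
Proof. by move=> PQ Pc A nA; apply: Pc; apply: contra nA => /PQ. Qed.

Lemma supp_mem P c A : supp P c -> c A != 0 -> P A.
Proof. by move=> Pc; apply: contraNT => /Pc ->. Qed.

Lemma supp_eq0 P c : supp P c -> (forall A, ~~ P A) -> c = 0.
Proof. by move=> Pc nP; apply/ffunP => A; rewrite Pc // ffunE. Qed.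

Definition delta (A : {set T}) : C := [ffun B => (B == A)%:R].

Lemma chain_sum_delta (c : C) : c = \sum_A c A *: delta A.
Proof. exact: ffun_sum_delta. Qed.

Lemma supp_delta (P : pred {set T}) A : P A -> supp P (delta A).
Proof. by move=> PA B; rewrite ffunE; case: eqP => // ->; rewrite PA. Qed.

Lemma supp_bd (P Q : pred {set T}) c :
  (forall (F : {set T}) v, v \notin F -> P (v |: F) -> Q F) ->
  supp P c -> supp Q (bd c).
Proof.
move=> PQ Pc F nQ; rewrite ffunE big1 // => v vF.
by rewrite Pc ?mulr0 //; apply: contra nQ; apply: PQ.
Qed.

Definition restr (P : pred {set T}) (c : C) : C :=
  [ffun A => if P A then c A else 0].

Lemma restr_is_linear P : linear (restr P).
Proof.
move=> a c b; apply/ffunP => F; rewrite !ffunE; case: ifP => //.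
by rewrite scaler0 addr0.
Qed.
HB.instance Definition _ P :=
  GRing.isLinear.Build K C C *:%R (restr P) (restr_is_linear P).

Lemma supp_restr (P Q : pred {set T}) c : supp Q c ->
  supp [pred A | P A & Q A] (restr P c).
Proof. by move=> Qc A; rewrite ffunE /=; case: (P A) => //= /Qc. Qed.

Lemma restr_supp P c : supp P c -> restr P c = c.
Proof. by move=> Pc; apply/ffunP => A; rewrite ffunE; case: ifPn => // /Pc. Qed.

Definition in_size (m : {set T}) n : pred {set T} :=
  fun A => (A \subset m) && (#|A| == n).

Lemma supp_bd_size m n c : supp (in_size m n.+1) c -> supp (in_size m n) (bd c).
Proof.
apply: supp_bd => F v vF; rewrite /in_size subUset cardsU1 vF add1n eqSS.
by case/andP=> /andP[_ ->].
Qed.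

(** Coning from any vertex of [m] fills the cycle; for n = 0 this is exactness at the empty face of
    the augmented complex. *)
Lemma simplex_exact m n c : m != set0 -> supp (in_size m n) c -> bd c = 0 ->
  exists b, supp (in_size m n.+1) b /\ bd b = c.
Proof.
case/set0Pn=> a am cm zc; exists (cone a c); split; last first.
  by have := bd_cone a c; rewrite zc (_ : cone a 0 = 0) ?addr0 //;
     apply/ffunP => A; rewrite !ffunE; case: ifP; rewrite ?mulr0.
move=> A; rewrite ffunE; case: ifPn => // aA nA.
rewrite cm ?mulr0 //; apply: contra nA; rewrite /in_size => /andP[sm sz].
by rewrite -(setD1K aA) subUset sub1set am sm cardsU1 setD11 (eqP sz) /=.
Qed.

Lemma bd_delta_neq0 (A : {set T}) v : v \in A -> bd (delta A) (A :\ v) != 0.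
Proof.
move=> vA; rewrite ffunE (bigD1 v) ?setD11 //= big1 => [|u /andP[uA uv]].
  by rewrite ffunE setD1K // eqxx mulr1 addr0 sgn_neq0.
rewrite ffunE; case: eqP => [eA|]; rewrite ?mulr0 //.
by have := vA; rewrite -eA !inE eqxx orbF eq_sym (negPf uv).
Qed.

End Chains.

(** * Combinatorics of a closure operator *)

(** The axioms constrain [cl] on subsets of [V] only. The last two say that the bottom element is
    the empty set and that the vertices are the atoms. *)
Record closure_op (T : finType) (V : {set T}) (cl : {set T} -> {set T}) : Prop :=
  ClosureOp {
    cl_ext : forall A : {set T}, A \subset V -> A \subset cl A;
    cl_sub : forall A : {set T}, A \subset V -> cl A \subset V;
    cl_min : forall A B : {set T}, A \subset V -> B \subset V ->
      A \subset cl B -> cl A \subset cl B;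
    cl_set0 : cl set0 = set0;
    cl_set1 : forall v, v \in V -> cl [set v] = [set v] }.

Section Gamma.
Variables (K : fieldType) (T : finType) (cl : {set T} -> {set T}).
Local Notation C := {ffun {set T} -> K^o}.

Definition gam (m : {set T}) n : pred {set T} :=
  fun A => [&& A \subset m, cl A != m & #|A| == n].

(* The complex of the sets with closure below [m] has no homology on faces with
   [n] vertices; for [m] the closed set of a multidegree this group is
   Tor_{n+1} of the quotient by the ideal. *)
Definition gam_exact n m := forall c : C, supp (gam m n) c -> bd c = 0 ->
  exists b : C, supp (gam m n.+1) b /\ bd b = c.

End Gamma.

Section Closure.
Variables (T : finType) (V : {set T}) (cl : {set T} -> {set T}).
Hypothesis hcl : closure_op V cl.

Lemma cl_mono (A B : {set T}) : A \subset B -> B \subset V -> cl A \subset cl B.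
Proof.
move=> AB BV; apply: (cl_min hcl) => //; first exact: subset_trans BV.
exact: subset_trans (cl_ext hcl BV).
Qed.

Lemma cl_idem (A : {set T}) : A \subset V -> cl (cl A) = cl A.
Proof.
move=> AV; have clV := cl_sub hcl AV; apply/eqP; rewrite eqEsubset (cl_ext hcl clV).
by rewrite (cl_min hcl).
Qed.

(** Hereditarily closed sets: these turn out to be the Scarf complex, see [mem_scarf_complex]. *)
Definition face (A : {set T}) :=
  (A \subset V) && [forall B : {set T}, (B \subset A) ==> (cl B == B)].

Lemma face_subV A : face A -> A \subset V.
Proof. by case/andP. Qed.

Lemma face_cl A : face A -> cl A = A.
Proof. by case/andP=> _ /forallP/(_ A)/implyP/(_ (subxx _))/eqP. Qed.

Lemma face_sub (A B : {set T}) : face A -> B \subset A -> face B.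
Proof.
case/andP=> AV /forallP fA BA; rewrite /face (subset_trans BA AV) /=.
apply/forallP => D; apply/implyP => DB.
by apply: (implyP (fA D)); apply: subset_trans BA.
Qed.

Lemma face0 : face set0.
Proof.
rewrite /face sub0set; apply/forallP => B; rewrite subset0; apply/implyP => /eqP->.
by rewrite (cl_set0 hcl).
Qed.

Definition min_nonface (A : {set T}) :=
  [/\ A \subset V, cl A != A & forall B : {set T}, B \proper A -> cl B = B].

Lemma nonface_min (A : {set T}) : A \subset V -> ~~ face A ->
  exists2 A0 : {set T}, A0 \subset A & min_nonface A0.
Proof.
move=> AV; rewrite /face AV /= negb_forall => /existsP[B0].
rewrite negb_imply => PB0.
pose P (B : {set T}) := (B \subset A) && (cl B != B).
case: (arg_minnP (P := P) (fun B : {set T} => #|B|) PB0) => B /andP[BA nB] minB.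
exists B => //; split=> //; first exact: subset_trans AV.
move=> D DB; apply/eqP/negPn/negP => nD; have := proper_card DB.
by rewrite ltnNge minB // /P nD (subset_trans (proper_sub DB) BA).
Qed.

Lemma min_nonfaceP (A : {set T}) : A \subset V -> cl A != A ->
  (forall B : {set T}, (#|B| < #|A|)%N -> B \subset V -> face B) -> min_nonface A.
Proof.
move=> AV nA h; split=> // B BA; apply/face_cl/h; first exact: proper_card.
exact: subset_trans (proper_sub BA) AV.
Qed.

Variable K : fieldType.
Local Notation C := {ffun {set T} -> K^o}.

Lemma gam_in_size m n (A : {set T}) : gam cl m n A -> in_size m n A.
Proof. by rewrite /gam /in_size => /and3P[-> _ ->]. Qed.

(** Closure operator of the closed sets together with a minimal nonface [A0]. No other closure
    changes, since the proper subsets of [A0] are closed already. *)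
Definition cl_add (A0 A : {set T}) := if A == A0 then A0 else cl A.

(** * Faces and Gamma under the homological form of maximality *)

Variable p : nat.
Hypothesis p_gt0 : (0 < p)%N.
Hypothesis V0 : V != set0.
(** [H1] says that Tor_{n+1} vanishes for n >= p, and [H2] that Tor_p does not. [H3] is maximality:
    if Tor_{p+1} vanished for the lattice enlarged by [A0], its projective dimension would be at
    most p. *)
Hypothesis H1 : forall m : {set T}, m \subset V -> cl m = m ->
  forall n, (p <= n)%N -> gam_exact K cl n m.
Hypothesis H2 :
  exists m : {set T}, [/\ m \subset V, cl m = m & ~ gam_exact K cl p.-1 m].
Hypothesis H3 : forall A0 : {set T}, min_nonface A0 ->
  ~ (forall m : {set T}, m \subset V -> cl_add A0 m = m -> gam_exact K (cl_add A0) p m).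

(** If the conclusion failed, every Gamma_m of the enlarged closure system would be exact on faces
    with p vertices, against [H3]. *)
Lemma min_nonface_bounds A0 : min_nonface A0 -> (#|A0| <= p)%N ->
  #|A0| = p /\ exists b : C, supp (gam cl (cl A0) p) b /\ bd b = bd (delta K A0).
Proof.
move=> mA0 szA0; apply: NNPP => nb; apply: (H3 mA0) => m mV.
case: mA0 => A0V nA0 subA0.
(* For m = A0 the new Gamma_m is the boundary of the simplex [A0], which has no face with p
   vertices. *)
rewrite {1}/cl_add; case: eqP => [-> _|mA0 clm].
  move=> c c_supp _; exists 0; rewrite linear0; split; first exact: supp0.
  symmetry; apply: supp_eq0 c_supp _ => A; apply/and3P => -[AA0 nA /eqP szA].
  have : A \proper A0.
    by rewrite properEneq AA0 andbT; apply: contra nA => /eqP->; rewrite /cl_add eqxx.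
  by move/proper_card; rewrite szA ltnNge szA0.
(* Gamma_m gains the face [A0] only when m is the old closure of [A0]. *)
have [eA0|nA0m] := eqVneq (cl A0) m; last first.
  have e k : gam (cl_add A0) m k =1 gam cl m k.
    move=> A; rewrite /gam /cl_add; case: (A =P A0) => // ->.
    by rewrite nA0m [_ == m]eq_sym; case: eqP mA0.
  move=> c c_supp zc; have /(H1 mV clm) : (p <= p)%N by [].
  case/(_ c); [by move=> A; rewrite -e; apply: c_supp|by []|] => b [b_supp <-].
  by exists b; split=> // A; rewrite e; apply: b_supp.
move=> c c_supp zc.
have c'_supp : supp (gam cl m p) (c - c A0 *: delta K A0).
  move=> A nA; rewrite !ffunE; case: eqP => [->|/eqP AA0].
    by rewrite /GRing.scale /= mulr1 subrr.
  rewrite scaler0 subr0; apply: c_supp; apply: contra nA.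
  by rewrite /gam /cl_add (negPf AA0).
have [z|nz] := eqVneq (c A0) 0.
  move: c'_supp; rewrite z scale0r subr0 => c'_supp.
  have [b [b_supp <-]] := H1 mV clm (leqnn p) c'_supp zc.
  exists b; split=> //; apply: supp_sub b_supp => A; rewrite /gam /cl_add.
  by case: (A =P A0) => // ->; rewrite eA0 eqxx andbF.
have szA0' : #|A0| = p by case/and3P: (supp_mem c_supp nz) => _ _ /eqP.
(* The cycle c is c(A0) times [A0] plus a chain of the old Gamma_m; taking boundaries and dividing
   by c(A0) bounds the boundary of [A0] there. *)
case: nb; split=> //; exists (- (c A0)^-1 *: (c - c A0 *: delta K A0)); split.
  by rewrite eA0; apply: suppZ.
rewrite linearZ /= linearB /= linearZ /= zc sub0r scaleNr scalerN opprK scalerA.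
by rewrite mulVf // scale1r.
Qed.

Lemma skeleton_face (F : {set T}) : F \subset V -> (#|F| < p)%N -> face F.
Proof.
move=> FV szF; apply/negPn/negP => /(nonface_min FV)[A0 A0F /min_nonface_bounds].
have lt : (#|A0| < p)%N by apply: leq_ltn_trans szF; apply: subset_leq_card.
by case/(_ (ltnW lt)) => e _; rewrite e ltnn in lt.
Qed.

(** For n < p, fill the cycle in the simplex on [m]. Sets with fewer than p elements are faces, so
    their closure is not the nonface [m]. Sets of size p with closure [m] are minimal nonfaces, and
    [min_nonface_bounds] trades each for a chain of Gamma_m with the same boundary. *)
Lemma nonface_gam_exact (m : {set T}) n : m \subset V -> cl m = m ->
  ~~ face m -> gam_exact K cl n m.
Proof.
move=> mV clm nfm; have [pn|ltnp] := leqP p n; first exact: H1.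
move=> c c_supp zc.
have m0 : m != set0 by apply: contraNneq nfm => ->; exact: face0.
have [b [b_supp bc]] := simplex_exact m0 (supp_sub (@gam_in_size m n) c_supp) zc.
move: ltnp; rewrite leq_eqVlt => /orP[/eqP n1p|n1p]; last first.
  exists b; split=> //; apply: supp_sub b_supp => A /andP[Am /eqP szA].
  rewrite /gam Am szA eqxx andbT /=.
  have fA : face A by apply: skeleton_face; rewrite ?szA ?(subset_trans Am).
  by apply: contraNneq nfm => <-; rewrite (face_cl fA).
have /fin_all_exists[e he] (A : {set T}) : exists e : C, supp (gam cl m p) e /\
    (in_size m p A -> bd e = bd (delta K A)).
  have [|_] := boolP (in_size m p A); last by exists 0; split; first exact: supp0.
  move=> /andP[Am /eqP szA]; have AV := subset_trans Am mV.
  have [clA|nA] := eqVneq (cl A) m; last first.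
    by exists (delta K A); split=> //; apply: supp_delta; rewrite /gam Am nA szA eqxx.
  have mA : min_nonface A.
    apply: min_nonfaceP => // [|B]; last by rewrite szA => ? ?; apply: skeleton_face.
    apply: contra nfm => /eqP eA; rewrite -clA eA /face AV; apply/forallP => B.
    apply/implyP => BA; have [->|nBA] := eqVneq B A; first by rewrite eA.
    rewrite (face_cl (skeleton_face _ _)) // ?(subset_trans BA) // -szA proper_card //.
    by rewrite properEneq nBA.
  have [_ [e]] := min_nonface_bounds mA (eq_leq szA).
  by rewrite clA => -[e_supp be]; exists e.
exists (\sum_A b A *: e A); split.
  by apply: supp_sum => A _; apply: suppZ; rewrite n1p; case: (he A).
rewrite -bc [in RHS](chain_sum_delta b) !linear_sum; apply: eq_bigr => A _.
rewrite !linearZ /=; have [->|nz] := eqVneq (b A) 0; first by rewrite !scale0r.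
by case: (he A) => _ -> //; rewrite -n1p; apply: supp_mem nz.
Qed.

(** For a face A, Gamma_A is the boundary sphere of the simplex A, with nonzero homology on the
    faces with one vertex less than A; by [H1] their size is below p. *)
Lemma face_card A : face A -> (#|A| <= p)%N.
Proof.
move=> fA; rewrite leqNgt; apply/negP => ltpA.
have [AV clA] := (face_subV fA, face_cl fA).
have [v vA] : exists v, v \in A by apply/card_gt0P; apply: leq_ltn_trans ltpA.
have szA : #|A| = #|A|.-1.+1 by rewrite prednK // (leq_ltn_trans _ ltpA).
have pA : (p <= #|A|.-1)%N by rewrite -ltnS -szA.
have [||b [b_supp bb]] := H1 AV clA pA (c := bd (delta K A)).
- apply: supp_bd (supp_delta K (P := pred1 A) _); last by rewrite /= eqxx.
  move=> F u uF /= /eqP eA; have FA : F \subset A by rewrite -eA subsetUr.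
  rewrite /gam FA (face_cl (face_sub fA FA)) -eA cardsU1 uF eqxx andbT /=.
  by apply: contraNneq uF => ->; rewrite setU11.
- exact: bd_bd.
have /eqP := bd_delta_neq0 K vA; apply.
(* A filling would live on subsets of A with as many elements as A but another closure, and there
   are none. *)
rewrite -bb (_ : b = 0) ?linear0 ?ffunE //; apply: supp_eq0 b_supp _ => B.
apply/and3P => -[BA nB szB]; case/negP: nB.
have -> : B = A by apply/eqP; rewrite eqEcard BA (eqP szB) -szA leqnn.
by rewrite clA.
Qed.

(** The multidegree m of [H2] must be a face, as nonfaces have exact Gamma. Then Gamma_m is the
    boundary of the simplex m, which has homology on faces with p - 1 vertices only if m has p
    elements. *)
Lemma face_card_eq : exists2 A : {set T}, face A & #|A| = p.
Proof.
have [m [mV clm nv]] := H2.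
have fm : face m by apply/negPn/negP => /(nonface_gam_exact mV clm).
exists m => //; have [lt|lt|//] := ltngtP #|m| p; case: nv => c c_supp zc.
  exists 0; rewrite linear0; split; first exact: supp0.
  symmetry; apply: supp_eq0 c_supp _ => A; apply/and3P => -[Am nA /eqP szA].
  have : A \proper m.
    by rewrite properEneq Am andbT; apply: contraNneq nA => ->; rewrite clm.
  by move/proper_card; rewrite szA ltnNge -ltnS prednK // lt.
have m0 : m != set0 by rewrite -card_gt0 (leq_ltn_trans _ lt).
have [b [b_supp bc]] := simplex_exact m0 (supp_sub (@gam_in_size m _) c_supp) zc.
exists b; split=> //; apply: supp_sub b_supp => A /andP[Am szA].
rewrite /gam Am szA andbT /= (face_cl (face_sub fm Am)).
by apply: contraTneq lt => <-; rewrite (eqP szA) prednK // ltnn.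
Qed.

(** The closed sets dealt with at stage j of [face_acyclic]. *)
Definition good j (m : {set T}) :=
  [&& m \subset V, cl m == m, ~~ face m & #|m| == j].

Lemma face_acyclic n (c : C) :
  supp (fun A : {set T} => face A && (#|A| == n)) c -> bd c = 0 ->
  exists b : C, supp (fun A : {set T} => face A && (#|A| == n.+1)) b /\ bd b = c.
Proof.
move=> c_supp zc.
(* Invariant of a descent on j: the nonfaces used by the filling have closures with fewer than j
   elements. For j = 0 only faces remain. *)
pose P j (A : {set T}) :=
  [&& A \subset V, #|A| == n.+1 & face A || (#|cl A| < j)%N].
suff /(_ 0%N)[b [b_supp <-]] : forall j, exists b : C, supp (P j) b /\ bd b = c.
  exists b; split=> //; apply: supp_sub b_supp => A /and3P[_ ->].
  by rewrite ltn0 orbF andbT.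
move=> j; case: (leqP j #|T|.+1) => [|/ltnW]; last first.
  move=> lej; have [|b [b_supp bc]] := simplex_exact V0 _ zc (n := n).
    by apply: supp_sub c_supp => A /andP[/face_subV AV szA]; rewrite /in_size AV.
  exists b; split=> //; apply: supp_sub b_supp => A /andP[AV szA].
  by rewrite /P AV szA /= (leq_trans _ lej) ?orbT // ltnS max_card.
move: {2}(_ - j)%N (erefl (#|T|.+1 - j)%N) => i; elim: i j => [|i IH] j ei lej.
  have {ei lej} -> : j = #|T|.+1.
    by apply/eqP; rewrite eqn_leq lej /= -subn_eq0 ei.
  have [|b [b_supp bc]] := simplex_exact V0 _ zc (n := n).
    by apply: supp_sub c_supp => A /andP[/face_subV AV szA]; rewrite /in_size AV.
  exists b; split=> //; apply: supp_sub b_supp => A /andP[AV szA].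
  by rewrite /P AV szA /= ltnS max_card orbT.
have ltj : (j < #|T|.+1)%N by rewrite -subn_gt0 ei.
have [|//|b [b_supp bc]] := IH j.+1; first by rewrite subnS ei.
have bP A : b A != 0 -> P j.+1 A by apply: supp_mem.
have /fin_all_exists[e he] (m : {set T}) : exists e : C,
    supp (gam cl m n.+1) e /\
    (good j m -> bd e = bd (restr [pred A | cl A == m] b)).
  have [|_] := boolP (good j m); last by exists 0; split; first exact: supp0.
  case/and4P => mV /eqP clm nfm /eqP szm.
  have [||e [e_supp be]] := nonface_gam_exact (n := n) mV clm nfm
    (c := bd (restr [pred A | cl A == m] b)); last by exists e.
  (* The boundary of this part of b lies in Gamma_m. If F has closure m, it is no face, so a set of
     b having F as a facet is no face either and by size has closure m as well. The coefficient at F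
     is thus that of bd b = c, which vanishes off the faces. *)
  - move=> F nF; have [clF|nclF] := eqVneq (cl F) m; last first.
      rewrite ffunE big1 // => v vF; rewrite ffunE /=.
      case: eqP => [clvF|]; rewrite ?mulr0 //.
      have [->|/bP/and3P[vFV szvF _]] := eqVneq (b (v |: F)) 0; first by rewrite mulr0.
      case/negP: nF; rewrite /gam nclF; move: szvF; rewrite cardsU1 vF eqSS => ->.
      rewrite !andbT -clvF; apply: subset_trans (cl_ext hcl vFV); exact: subsetUr.
    have [FV|nFV] := boolP (F \subset V); last first.
      rewrite ffunE big1 // => v vF; rewrite ffunE /=.
      case: eqP; rewrite ?mulr0 // => _.
      have [->|/bP/and3P[vFV _ _]] := eqVneq (b (v |: F)) 0; first by rewrite mulr0.
      by case/negP: nFV; apply: subset_trans vFV; apply: subsetUr.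
    have nfF : ~~ face F by apply: contra nfm => fF; rewrite -clF (face_cl fF).
    transitivity (bd b F); last by rewrite bc c_supp // (negPf nfF).
    rewrite !ffunE; apply: eq_bigr => v vF; rewrite ffunE /=; case: eqP => // nvF.
    have [->//|/bP/and3P[vFV _ /orP[fvF|lt]]] := eqVneq (b (v |: F)) 0.
      by case/negP: nfF; apply: face_sub fvF _; apply: subsetUr.
    case: nvF; apply/esym/eqP; rewrite eqEcard szm -ltnS lt andbT -clF.
    by apply: cl_mono; first exact: subsetUr.
  - exact: bd_bd.
(* The parts of b over the good m are exchanged for chains of Gamma_m, whose sets have strictly
   smaller closures. *)
exists (restr [pred A | ~~ good j (cl A)] b + \sum_(m | good j m) e m); split.
  apply: suppD; last first.
    apply: supp_sum => m gm; have [e_supp _] := he m.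
    case/and4P: gm => mV /eqP clm nfm /eqP szm.
    apply: supp_sub e_supp => A /and3P[Am nA szA].
    rewrite /P (subset_trans Am mV) szA /= -szm proper_card ?orbT //.
    by rewrite properEneq nA -clm cl_mono.
  apply: supp_sub (supp_restr b_supp) => A /= /and4P[ngA AV szA].
  rewrite /P AV szA /=; case fA: (face A) => //=; rewrite ltnS leq_eqVlt.
  case/orP => // eA; case/negP: ngA.
  rewrite /good (cl_sub hcl) // cl_idem // eqxx eA andbT /=.
  by apply: contraFN fA => fclA; apply: face_sub fclA (cl_ext hcl AV).
rewrite linearD linear_sum -bc /=.
have {2}-> : b = restr [pred A | ~~ good j (cl A)] b +
    \sum_(m | good j m) restr [pred A | cl A == m] b.
  apply/ffunP => A; rewrite !ffunE sum_ffunE /=; case: ifPn => gA.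
    rewrite big1 ?addr0 // => m gm; rewrite ffunE /=; case: eqP => // em.
    by case/negP: gA; rewrite em.
  rewrite add0r (bigD1 (cl A)) /=; last by rewrite negbK in gA.
  rewrite ffunE /= eqxx big1 ?addr0 // => m /andP[_ /negPf nm].
  by rewrite ffunE /= eq_sym nm.
rewrite linearD linear_sum /=; congr (_ + _); apply: eq_bigr => m gm.
by case: (he m) => _ ->.
Qed.

End Closure.

(** * Projective resolutions *)

Section Kernel.
Variables (R : nzRingType) (M N : lmodType R) (f : {linear M -> N}).

Definition kerp : {pred M} := fun x => f x == 0.

Lemma kerp_submod : submod_closed kerp.
Proof.
split; first by rewrite unfold_in linear0.
by move=> a x y; rewrite !unfold_in linearP => /eqP-> /eqP->; rewrite scaler0 addr0.
Qed.
HB.instance Definition _ := GRing.isSubmodClosed.Build R M kerp kerp_submod.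

Record ker := Ker { kval : M; _ : kval \in kerp }.
HB.instance Definition _ := [isSub for kval].
HB.instance Definition _ := [Choice of ker by <:].
HB.instance Definition _ := [SubChoice_isSubLmodule of ker by <:].

Lemma ker_eq0 (x : ker) : f (val x) = 0.
Proof. by apply/eqP; case: x. Qed.

Section Corestriction.
Variables (A : lmodType R) (g : {linear A -> M}) (fg0 : forall x, f (g x) = 0).

Definition corestr (x : A) : ker := Ker (introT eqP (fg0 x) : g x \in kerp).

Lemma corestr_is_linear : linear corestr.
Proof. by move=> a x y; apply: val_inj; rewrite /= linearP. Qed.
HB.instance Definition _ := GRing.isLinear.Build R A ker *:%R corestr corestr_is_linear.

End Corestriction.
End Kernel.

Section Projective.
Variable R : nzRingType.

Lemma retract_projective (P F : lmodType R) (i : {linear P -> F})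
  (r : {linear F -> P}) : cancel i r -> projective F -> projective P.
Proof.
move=> ri projF M N f g sf.
have [h fh] := projF M N f (g \o r) sf.
by exists (h \o i : {linear P -> M}) => x; rewrite /= fh /= ri.
Qed.

(** By exactness [d] corestricts to a surjection onto the kernel of [e], through which [f]
    factors. *)
Lemma projective_lift (P A B C : lmodType R) (d : {linear A -> B})
    (e : {linear B -> C}) (f : {linear P -> B}) : projective P ->
  (forall x, e x = 0 <-> exists y, d y = x) -> (forall x, e (f x) = 0) ->
  exists h : {linear P -> A}, forall x, d (h x) = f x.
Proof.
move=> projP ex ef0.
have ed0 y : e (d y) = 0 by apply/ex; exists y.
have [|h dh] := projP A (ker e) (corestr ed0) (corestr ef0).
  move=> x; have [y dy] := (ex (val x)).1 (ker_eq0 x).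
  by exists y; apply: val_inj.
by exists h => x; have /(congr1 val) := dh x.
Qed.

Lemma free_projective (I : finType) : projective {ffun I -> R^o}.
Proof.
move=> M N f g sf; pose dl (i : I) : {ffun I -> R^o} := [ffun j => (j == i)%:R].
have /fin_all_exists[m fm] (i : I) : exists y, f y = g (dl i) by apply: sf.
pose h (x : {ffun I -> R^o}) := \sum_i x i *: m i.
have lin_h : linear h.
  move=> a x y; rewrite /h scaler_sumr -big_split; apply: eq_bigr => i _ /=.
  by rewrite !ffunE scalerDl scalerA.
pose hL := HB.pack h (GRing.isLinear.Build _ _ _ _ h lin_h) :
  {linear {ffun I -> R^o} -> M}.
exists hL => x; rewrite /= /h linear_sum.
rewrite [in RHS](ffun_sum_delta x).
by rewrite linear_sum; apply: eq_bigr => i _; rewrite !linearZ /= fm.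
Qed.

End Projective.

(** Chain maps and homotopies are built degree by degree between modules that vary with the degree;
    [Q] is the invariant that makes the next step possible. *)
Lemma dependent_choice (S : nat -> Type) (Q : forall i, S i -> Prop)
    (Rel : forall i, S i -> S i.+1 -> Prop) (x0 : S 0%N) :
  (forall i x, Q i x -> exists y, Rel i x y) ->
  (forall i x y, Rel i x y -> Q i.+1 y) -> Q 0%N x0 ->
  exists f : forall i, S i, f 0%N = x0 /\ forall i, Rel i (f i) (f i.+1).
Proof.
move=> step pres Qx0.
have next i (x : {x | Q i x}) : {y : {y | Q i.+1 y} | Rel i (sval x) (sval y)}.
  case: x => x Qx; have [y Rxy] := constructive_indefinite_description _ (step i x Qx).
  by exists (exist _ y (pres i x y Rxy)).
pose f := nat_rect (fun i => {x | Q i x}) (exist _ x0 Qx0) (fun i x => sval (next i x)).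
by exists (fun i => sval (f i)); split=> // i; apply: (svalP (next i (f i))).
Qed.

(** * Comparison maps and homotopies between resolutions *)

Section Comparison.
Variable R : nzRingType.

(** The term of index 0 is the resolved module itself, so that the augmentation is treated as one
    more differential; only the terms of positive index are projective later on. *)
Definition exact_seq (X : nat -> lmodType R) (d : forall i, {linear X i.+1 -> X i}) :=
  surj (d 0%N) /\ forall i x, d i x = 0 <-> exists y, d i.+1 y = x.

Variables (X Y : nat -> lmodType R).
Variables (dX : forall i, {linear X i.+1 -> X i})
  (dY : forall i, {linear Y i.+1 -> Y i}).
Hypotheses (projX : forall i, projective (X i.+1)).
Hypotheses (exX : exact_seq dX) (exY : exact_seq dY).

Let dX0 i x : dX i (dX i.+1 x) = 0.
Proof. by apply/(exX.2 i); exists x. Qed.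

Lemma comparison (f0 : {linear X 0%N -> Y 0%N}) :
  exists f : forall i, {linear X i -> Y i}, f 0%N = f0 /\
    forall i x, dY i (f i.+1 x) = f i (dX i x).
Proof.
(* A partial chain map extends once it sends cycles to cycles; at index 0 surjectivity of the
   augmentation is enough. *)
pose Q i (f : {linear X i -> Y i}) :=
  match i return {linear X i -> Y i} -> Prop with
  | 0%N => fun _ => True
  | j.+1 => fun f => forall x, dX j x = 0 -> dY j (f x) = 0
  end f.
apply: (@dependent_choice _ Q
  (fun i f g => forall x, dY i (g x) = f (dX i x))) => // [[|i] f Qf|i f g fg x dx].
- have [h dh] := projX (f \o dX 0%N) exY.1.
  by exists h => x; rewrite dh.
- have [|h dh] := projective_lift (f := f \o dX i.+1) (@projX i.+1) (exY.2 i).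
    by move=> x /=; apply: Qf; apply: dX0.
  by exists h => x; rewrite dh.
- by rewrite fg dx linear0.
Qed.

Lemma null_homotopy (f : forall i, {linear X i -> Y i}) :
  (forall x, f 0%N x = 0) -> (forall i x, dY i (f i.+1 x) = f i (dX i x)) ->
  exists s : forall i, {linear X i -> Y i.+1},
    forall i x, f i.+1 x = dY i.+1 (s i.+1 x) + s i (dX i x).
Proof.
move=> f0 fd.
have [|||s [_ hs]] := @dependent_choice (fun i => {linear X i -> Y i.+1})
  (* The invariant says that f_{i+1} - s_i d is killed by the differential, hence lifts to
     s_{i+1}. *)
  (fun i s => forall x, dY i (s (dX i x)) = f i (dX i x))
  (fun i s s' => forall x, dY i.+1 (s' x) = f i.+1 x - s (dX i x)) \0.
- move=> i s Qs.
  have [|h dh] := projective_lift (f := f i.+1 \- (s \o dX i)) (@projX i) (exY.2 i).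
    by move=> x /=; rewrite linearB /= fd Qs subrr.
  by exists h => x; rewrite dh.
- by move=> i s s' hs x; rewrite hs dX0 linear0 subr0.
- by move=> x /=; rewrite linear0 f0.
by exists s => i x; rewrite hs subrK.
Qed.

End Comparison.

Section Augmentation.
Variables (R : nzRingType) (M : lmodType R) (P : nat -> lmodType R).
Variables (d : forall i, {linear P i.+1 -> P i}) (e : {linear P 0%N -> M}).

Definition aug i : lmodType R := if i is j.+1 then P j else M.

Definition aug_d i : {linear aug i.+1 -> aug i} :=
  match i return {linear aug i.+1 -> aug i} with 0%N => e | j.+1 => d j end.

Lemma aug_exact : surj e -> (forall x, e x = 0 <-> exists y, d 0%N y = x) ->
  (forall i x, d i x = 0 <-> exists y, d i.+1 y = x) -> exact_seq aug_d.
Proof. by move=> se ee ed; split=> // -[|i] x; [apply: ee | apply: ed]. Qed.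

End Augmentation.

(** The identity of [T] is homotopic to a composite through the resolution of length q, and that
    composite vanishes in degrees above q. *)
Lemma resolution_contraction (R : nzRingType) (M : lmodType R) q
    (T : nat -> lmodType R) (d : forall i, {linear T i.+1 -> T i})
    (e : {linear T 0%N -> M}) :
  (forall i, projective (T i)) -> surj e ->
  (forall x, e x = 0 <-> exists y, d 0%N y = x) ->
  (forall i x, d i x = 0 <-> exists y, d i.+1 y = x) ->
  has_proj_resolution M q ->
  exists s : forall i, {linear T i -> T i.+1}, forall i, (q <= i)%N ->
    forall x, x = d i.+1 (s i.+1 x) + s i (d i x).
Proof.
move=> projT se exe exd [P [dP [eP [projP P0 seP exeP exdP]]]].
have exX := aug_exact se exe exd; have exY := aug_exact seP exeP exdP.
have [a [a0 da]] := comparison (X := aug M T) (Y := aug M P) projT exX exY idfun.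
have [b [b0 db]] := comparison (X := aug M P) (Y := aug M T) projP exY exX idfun.
have [||s hs] := null_homotopy projT exX exX
    (f := fun i => idfun \- (b i \o a i) : {linear aug M T i -> aug M T i}).
- by move=> x /=; rewrite a0 b0 subrr.
- by move=> i x /=; rewrite linearB /= db da.
exists (fun i => s i.+1) => i qi x; have := hs i.+1 x.
by rewrite /= [a i.+2 x](P0 i.+1 qi) linear0 subr0.
Qed.

(** * A filtered projector onto cycles *)

(** On the image of [Z] under [g], [tau] is a linear choice of preimages inside [Z]. *)
Lemma section_on_subspace (K : fieldType) (E : vectType K) (Z : {vspace E})
    (g : {linear E -> E}) :
  exists tau : {linear E -> E}, (forall c, tau c \in Z) /\
    (forall z, z \in Z -> g (tau (g z)) = g z).
Proof.
pose G := (linfun g \o projv Z)%VF.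
exists (projv Z \o G^-1)%VF; split=> [c|z zZ].
  by rewrite /= comp_lfunE memv_proj.
have Gz : G z = g z by rewrite comp_lfunE projv_id // lfunE.
have := limg_lfunVK (memv_img G (memvf z)).
by rewrite Gz {1}/G /= !comp_lfunE lfunE /= => ->.
Qed.

Section Splitting.
Variables (K : fieldType) (T : finType) (V : {set T}) (cl : {set T} -> {set T}).
Hypothesis hcl : closure_op V cl.
Local Notation C := {ffun {set T} -> K^o}.
Variable q : nat.
Hypothesis Hq : forall m : {set T}, m \subset V -> cl m = m -> gam_exact K cl q m.

Definition kcycle (m : {set T}) (c : C) : Prop := supp (in_size m q) c /\ bd c = 0.

Lemma cycleD m c c' : kcycle m c -> kcycle m c' -> kcycle m (c + c').
Proof.
by move=> [sc zc] [sc' zc']; split; [exact: suppD | rewrite linearD /= zc zc' addr0].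
Qed.

Lemma cycle_sub (m m' : {set T}) c : m \subset m' -> kcycle m c -> kcycle m' c.
Proof.
move=> mm' [sc zc]; split=> //; apply: supp_sub sc => A /andP[Am szA].
by rewrite /in_size szA (subset_trans Am).
Qed.

(** Graded piece at [m] of the filtration of chains by closed sets; for a cycle inside [m] it serves
    as the leading part. *)
Definition gr (m : {set T}) : C -> C := restr [pred A | in_size V q A & cl A == m].
HB.instance Definition _ m :=
  GRing.isLinear.Build K C C *:%R (gr m) (restr_is_linear _).

Lemma graded_section (m : {set T}) :
  exists tau : {linear C -> C}, (forall c, kcycle m (tau c)) /\
    (forall z, kcycle m z -> gr m (tau (gr m z)) = gr m z).
Proof.
pose Z := (lker (linfun (@bd K T)) :&:
           lker (linfun (idfun \- restr (in_size m q) : {linear C -> C})))%VS.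
have ZP c : c \in Z <-> kcycle m c.
  rewrite memv_cap !memv_ker !lfunE /= subr_eq0; split.
    move=> /andP[/eqP zc /eqP sc]; split=> // A nA.
    by rewrite sc ffunE (negPf nA).
  by move=> [sc ->]; rewrite eqxx restr_supp /=.
have [tau [tauZ htau]] := section_on_subspace Z
  (gr m : {linear C -> C}).
by exists tau; split=> [c|z cz]; [exact/ZP | exact/htau/ZP].
Qed.

Definition graded_sections (tau : {set T} -> {linear C -> C}) : Prop :=
  forall m, (forall c, kcycle m (tau m c)) /\
    (forall z, kcycle m z -> gr m (tau m (gr m z)) = gr m z).

Definition closed_in (m : {set T}) := (m \subset V) && (cl m == m).

Lemma gr_neq0 m c : gr m c != 0 ->
  exists A : {set T}, [/\ in_size V q A, cl A = m & c A != 0].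
Proof.
move=> nz; have [|/existsPn z] := boolP [exists A, gr m c A != 0].
  case/existsP => A; rewrite ffunE /=; case: ifP => [/andP[sA /eqP clA] nzA|].
    by exists A.
  by rewrite eqxx.
by case/eqP: nz; apply/ffunP => A; have := z A; rewrite negbK => /eqP ->; rewrite ffunE.
Qed.

Section Tau.
Variable tau_ : {set T} -> {linear C -> C}.
Hypothesis htau : graded_sections tau_.

(** Every graded piece is replaced by a cycle; for a cycle inside a closed set m the leading part is
    thereby preserved. *)
Definition tau (c : C) : C := \sum_(m | closed_in m) tau_ m (gr m c).

Lemma tau_is_linear : linear tau.
Proof.
move=> a c b; rewrite /tau scaler_sumr -big_split; apply: eq_bigr => m _ /=.
by rewrite !linearP.
Qed.
HB.instance Definition _ := GRing.isLinear.Build K C C *:%R tau tau_is_linear.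

Definition defect (c : C) : C := c - tau c.

Lemma defect_is_linear : linear defect.
Proof. by move=> a c b; rewrite /defect linearP opprD addrACA -scalerBr. Qed.
HB.instance Definition _ :=
  GRing.isLinear.Build K C C *:%R defect defect_is_linear.

Lemma iter_defect_is_linear k : linear (iter k defect).
Proof. by elim: k => [|k IH] a c b //=; rewrite IH linearP. Qed.
HB.instance Definition _ k :=
  GRing.isLinear.Build K C C *:%R (iter k defect) (iter_defect_is_linear k).

Lemma tau_cycle c : kcycle V (tau c).
Proof.
rewrite /tau; elim/big_ind: _ => [||m /andP[mV _]].
- by split; [exact: supp0 | rewrite linear0].
- exact: cycleD.
- by apply: cycle_sub mV _; case: (htau m).
Qed.

(** The sets of vertices whose lcm divides a fixed monomial are of this kind, so the statement makes
    [tau] compatible with multidegrees. *)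
Lemma tau_supp (P : pred {set T}) :
  (forall A B : {set T}, A \subset V -> P A -> B \subset cl A -> P B) ->
  forall c, supp P c -> supp P (tau c).
Proof.
move=> hP c sc; apply: supp_sum => m _.
have [->|/gr_neq0[A [/andP[AV _] clA /(supp_mem sc) PA]]] := eqVneq (gr m c) 0.
  by rewrite linear0; apply: supp0.
have [/(_ (gr m c))[stau _] _] := htau m.
by apply: supp_sub stau => B /andP[Bm _]; apply: hP PA _; rewrite ?clA.
Qed.

(** [tau] reproduces the part of z with closure m, and its other summands are supported in closed
    sets strictly inside m, so nothing with closure m survives in the difference. *)
Lemma defect_gam (m : {set T}) z : m \subset V -> cl m = m -> kcycle m z ->
  supp (gam cl m q) (defect z) /\ bd (defect z) = 0.
Proof.
move=> mV clm [sz zz]; split; last by rewrite linearB /= zz (tau_cycle z).2 subr0.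
have s_m : supp (in_size m q) (defect z).
  apply: suppB => //; apply: supp_sum => m' _.
  have [->|/gr_neq0[A [/andP[AV _] clA /(supp_mem sz)/andP[Am _]]]] :=
    eqVneq (gr m' z) 0.
    by rewrite linear0; apply: supp0.
  have [/(_ (gr m' z))[stau _] _] := htau m'.
  apply: supp_sub stau => B /andP[Bm szB]; rewrite /in_size szB andbT.
  apply: subset_trans Bm _; rewrite -clA -clm; exact: (cl_mono hcl).
move=> A; have [sA|/s_m //] := boolP (in_size m q A).
have [Am szA] := andP sA; rewrite /gam Am szA andbT negbK /= => /eqP clA.
have sVA : in_size V q A by rewrite /in_size szA (subset_trans Am).
rewrite !ffunE sum_ffunE (bigD1 m) /=; last by rewrite /closed_in mV clm /=.
have [_ /(_ z (conj sz zz)) /(congr1 (fun f : C => f A))] := htau m.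
rewrite ![gr _ _ A]ffunE /= sVA clA eqxx /= => ->.
rewrite big1 ?addr0 ?subrr // => m' /andP[/andP[m'V /eqP clm'] nm'].
have [->|/gr_neq0[B [/andP[BV _] clB /(supp_mem sz)/andP[Bm _]]]] :=
  eqVneq (gr m' z) 0.
  by rewrite linear0 ffunE.
have [/(_ (gr m' z))[stau _] _] := htau m'.
apply: stau; apply/andP => -[Am' _]; case/eqP: nm'; apply/eqP.
rewrite eqEsubset -{1}clB -clm (cl_mono hcl) //= clm -clA -clm'.
exact: (cl_mono hcl).
Qed.

(** Induction along the closed sets: [defect z] is a cycle of Gamma_m, so by [Hq] a combination of
    boundaries of simplices A of Gamma_m, and each of these is a cycle inside cl A, strictly smaller
    than m. *)
Lemma iter_defect_cycle k (m : {set T}) z : m \subset V -> cl m = m -> (#|m| < k)%N ->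
  kcycle m z -> iter k defect z = 0.
Proof.
elim: k m z => // k IH m z mV clm lt_mk cz; rewrite iterSr.
have [sd zd] := defect_gam mV clm cz.
have [b [sb <-]] := Hq mV clm sd zd.
rewrite (chain_sum_delta b) !linear_sum big1 // => A _ /=.
have [->|/(supp_mem sb)/and3P[Am nA szA]] := eqVneq (b A) 0.
  by rewrite scale0r !linear0.
have AV := subset_trans Am mV.
have clAm : cl A \proper m by rewrite properEneq nA -clm (cl_mono hcl).
have cA : kcycle (cl A) (bd (delta K A)).
  split; last exact: bd_bd.
  apply: supp_bd_size; apply: supp_delta; rewrite /in_size szA andbT.
  exact: (cl_ext hcl).
rewrite !linearZ /= (IH (cl A)) ?scaler0 ?(cl_sub hcl) ?(cl_idem hcl) //.
exact: leq_trans (proper_card clAm) _.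
Qed.

End Tau.

(* On cycles [tau] is the identity up to the nilpotent [defect], so some
   polynomial in [tau] is a projector onto the cycles. *)
Lemma cycle_projector : exists pi : {linear C -> C},
  [/\ forall c, kcycle V (pi c), forall z, kcycle V z -> pi z = z
    & forall P : pred {set T},
      (forall A B : {set T}, A \subset V -> P A -> B \subset cl A -> P B) ->
      forall c, supp P c -> supp P (pi c)].
Proof.
have /fin_all_exists[tau_ htau] (m : {set T}) := graded_section m.
have [N ltN] : exists N, forall m : {set T}, (#|m| < N)%N.
  by exists #|T|.+1 => m; rewrite ltnS max_card.
pose f := defect tau_.
(* 1 - (1 - tau)^N takes values in cycles because it is a multiple of tau, and it fixes cycles
   because (1 - tau)^N kills them. *)
exists (idfun \- (iter N f : {linear C -> C})); split=> [c|z cz|P hP c sc] /=.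
- elim: N {ltN} => [|N IH] /=.
    by rewrite subrr; split; [exact: supp0 | exact: linear0].
  set x := iter N f c; have -> : c - f x = c - x + tau tau_ x.
    by rewrite /f /defect opprB addrA addrAC.
  by apply: cycleD IH (tau_cycle htau _).
- have VV : cl V = V.
    by apply/eqP; rewrite eqEsubset (cl_sub hcl) // (cl_ext hcl).
  by rewrite (iter_defect_cycle htau _ VV) ?subr0.
- apply: suppB => //; elim: N {ltN} => [|N IH] //=.
  by apply: suppB => //; apply: tau_supp.
Qed.

End Splitting.

(** * The Taylor complex *)

Lemma mcoeffXM (R : nzRingType) n (m k : 'X_{1..n}) (p : {mpoly R[n]}) :
  ('X_[k] * p)@_m = if (k <= m)%MM then p@_(m - k) else 0.
Proof.
rewrite -commr_mpolyX; case: ifPn => [km|nkm].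
  by rewrite -{1}(submK km) addmC mcoeffMX.
apply: memN_msupp_eq0; rewrite (perm_mem (msuppMX p k)).
apply: contra nkm => /mapP[m' _ ->]; exact: lem_addr.
Qed.

Lemma mnmBB n (m : 'X_{1..n}) : (m - m)%MM = 0%MM.
Proof. by apply/mnmP => i; rewrite !mnmE subnn. Qed.

Section Taylor.
Variables (K : fieldType) (n : nat) (T : finType) (V : {set T}).
Variable g : T -> 'X_{1..n}.
Local Notation C := {ffun {set T} -> K^o}.
Local Notation S := {mpoly K[n]}.
Local Notation F := {ffun {set T} -> S^o}.

(** Exponent of the lcm of the generators indexed by [A], the multidegree of the Taylor basis
    element [A]. *)
Definition ell (A : {set T}) : 'X_{1..n} :=
  [multinom \max_(v in A) g v i | i < n].

Lemma ell_le A u : (ell A <= u)%MM = [forall v in A, (g v <= u)%MM].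
Proof.
apply/mnm_lepP/forall_inP => [h v vA|h i].
  apply/mnm_lepP => i; apply: leq_trans (h i); rewrite mnmE.
  exact: (leq_bigmax_cond (F := fun v => g v i)).
by rewrite mnmE; apply/bigmax_leqP => v vA; apply: (mnm_lepP (h v vA)).
Qed.

Lemma ell_mono (A B : {set T}) : A \subset B -> (ell A <= ell B)%MM.
Proof.
move=> /subsetP AB; rewrite ell_le; apply/forall_inP => v /AB vB.
have := lepm_refl (ell B); rewrite ell_le => /forall_inP; exact.
Qed.

Lemma lem_g v (A : {set T}) : v \in A -> (g v <= ell A)%MM.
Proof. by have := lepm_refl (ell A); rewrite {1}ell_le => /forall_inP; apply. Qed.

Lemma lem_anti (a b : 'X_{1..n}) : (a <= b)%MM -> (b <= a)%MM -> a = b.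
Proof.
move=> /mnm_lepP ab /mnm_lepP ba; apply/mnmP => i.
by apply/eqP; rewrite eqn_leq ab ba.
Qed.

Lemma ell0 : ell set0 = 0%MM.
Proof. by apply/mnmP => i; rewrite !mnmE big_set0. Qed.

Lemma ell1 v : ell [set v] = g v.
Proof. by apply/mnmP => i; rewrite !mnmE big_set1. Qed.

Definition ell_cl (A : {set T}) : {set T} := [set v in V | (g v <= ell A)%MM].

Lemma ell_cl_sub (A : {set T}) : ell_cl A \subset V.
Proof. by apply/subsetP => v; rewrite inE => /andP[]. Qed.

Lemma sub_ell_cl (A : {set T}) : A \subset V -> A \subset ell_cl A.
Proof. by move=> /subsetP AV; apply/subsetP => v vA; rewrite inE AV // lem_g. Qed.

Lemma ell_cl_le (A B : {set T}) : A \subset V ->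
  (A \subset ell_cl B) = (ell A <= ell B)%MM.
Proof.
move=> /subsetP AV; rewrite ell_le.
apply/subsetP/forall_inP => h v vA; last by rewrite inE AV // h.
by have := h v vA; rewrite inE => /andP[].
Qed.

Lemma ell_ell_cl (A : {set T}) : A \subset V -> ell (ell_cl A) = ell A.
Proof.
move=> AV; apply: lem_anti; last exact/ell_mono/sub_ell_cl.
by rewrite -ell_cl_le // ell_cl_sub.
Qed.

Hypothesis g_neq0 : forall v, v \in V -> g v != 0%MM.
Hypothesis g_anti : {in V &, forall u v, (g u <= g v)%MM -> u = v}.

Lemma ell_closure : closure_op V ell_cl.
Proof.
split=> [A|A _|A B AV BV AB||v vV]; [exact: sub_ell_cl|exact: ell_cl_sub| | |].
- by rewrite ell_cl_le ?ell_cl_sub // ell_ell_cl // -ell_cl_le.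
- apply/setP => v; rewrite !inE ell0; apply/negP => /andP[vV gv].
  by case/eqP: (g_neq0 vV); apply: lem_anti => //; apply/mnm_lepP => i; rewrite mnmE.
- apply/setP => u; rewrite !inE ell1; apply/andP/eqP => [[uV]|->].
    by move/g_anti; apply.
  by rewrite lepm_refl.
Qed.

Definition lesupp u : C -> Prop := supp (fun A => (ell A <= u)%MM).

Definition filtered (phi : C -> C) : Prop := forall u c, lesupp u c -> lesupp u (phi c).

(* The multidegree-[u] part of the Taylor complex is the chain complex of the
   simplex on the generators dividing [u]. *)
Definition mcomp u (f : F) : C :=
  [ffun A => if (ell A <= u)%MM then (f A : S)@_(u - ell A) else 0].

Lemma lesupp_comp u f : lesupp u (mcomp u f).
Proof. by move=> A; rewrite ffunE => /negPf ->. Qed.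

Lemma compD u : {morph mcomp u : f f' / f + f'}.
Proof.
move=> f f'; apply/ffunP => A; rewrite !ffunE.
by case: ifP; rewrite ?mcoeffD ?addr0.
Qed.

Lemma compN u : {morph mcomp u : f / - f}.
Proof.
move=> f; apply/ffunP => A; rewrite !ffunE.
by case: ifP; rewrite ?mcoeffN ?oppr0.
Qed.

Lemma comp0 u : mcomp u 0 = 0.
Proof. by apply/ffunP => A; rewrite !ffunE mcoeff0; case: ifP. Qed.

Lemma compB u : {morph mcomp u : f f' / f - f'}.
Proof. by move=> f f'; rewrite compD compN. Qed.

Lemma comp_sum u (I : Type) (r : seq I) (P : pred I) (f : I -> F) :
  mcomp u (\sum_(i <- r | P i) f i) = \sum_(i <- r | P i) mcomp u (f i).
Proof. exact: (big_morph _ (compD u) (comp0 u)). Qed.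

Lemma comp_inj f f' : (forall u, mcomp u f = mcomp u f') -> f = f'.
Proof.
move=> h; apply/ffunP => A; apply/mpolyP => m.
have /(congr1 (fun c : C => c A)) := h (m + ell A)%MM.
by rewrite !ffunE lem_addl addmK.
Qed.

(* Inverse to [mcomp] on maps: a K-linear map compatible with [ell] is
   homogenized to a multigraded S-linear map. *)
Definition mlift (phi : C -> C) (f : F) : F :=
  [ffun B => \sum_A (phi (delta K A) B *: 'X_[ell A - ell B] : S) * (f A : S)].

Lemma lift_is_linear phi : linear (mlift phi).
Proof.
move=> a f f'; apply/ffunP => B; rewrite !ffunE scaler_sumr -big_split.
apply: eq_bigr => A _ /=; rewrite !ffunE mulrDr; congr (_ + _).
by rewrite /GRing.scale /= mulrCA.
Qed.
HB.instance Definition _ phi :=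
  GRing.isLinear.Build S F F *:%R (mlift phi) (lift_is_linear phi).

Lemma filtered_delta phi (A B : {set T}) : filtered phi ->
  phi (delta K A) B != 0 -> (ell B <= ell A)%MM.
Proof.
move=> fphi; apply: contraR => nBA; apply/eqP; apply: (fphi (ell A)) nBA.
by apply: supp_delta; apply: lepm_refl.
Qed.

(** Being filtered makes the truncated subtraction of exponents in [mlift] a true quotient of
    monomials wherever the coefficient is nonzero. *)
Lemma comp_lift (phi : {linear C -> C}) u f : filtered phi ->
  mcomp u (mlift phi f) = phi (mcomp u f).
Proof.
move=> fphi; rewrite (chain_sum_delta (mcomp u f)) linear_sum.
apply/ffunP => B; rewrite sum_ffunE !ffunE.
have e A : (phi (mcomp u f A *: delta K A)) B = mcomp u f A * phi (delta K A) B.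
  by rewrite linearZ ffunE.
under [RHS]eq_bigr => A _ do rewrite e.
case: ifPn => Bu; last first.
  rewrite big1 // => A _.
  have [->|nz] := eqVneq (phi (delta K A) B) 0; first by rewrite mulr0.
  rewrite ffunE ifN ?mul0r //; apply: contra Bu; apply: lepm_trans.
  exact: filtered_delta nz.
rewrite raddf_sum; apply: eq_bigr => A _ /=.
rewrite -scalerAl mcoeffZ mcoeffXM ffunE mulrC.
have [->|/(filtered_delta fphi) BA] := eqVneq (phi (delta K A) B) 0.
  by rewrite !mulr0.
congr (_ * _).
have -> : (ell A - ell B <= u - ell B)%MM = (ell A <= u)%MM.
  apply/mnm_lepP/mnm_lepP => h i; last by rewrite !mnmBE leq_sub2r.
  by have := h i; rewrite !mnmBE leq_subLR subnKC //; apply: (mnm_lepP Bu).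
case: ifP => // _; congr (_@_ _); apply/mnmP => i; rewrite !mnmBE.
by rewrite subnBA ?subnK //; [apply: (mnm_lepP Bu) | apply: (mnm_lepP BA)].
Qed.

Lemma lift_restr P f : mlift (restr P) f = [ffun B => if P B then f B else 0].
Proof.
apply/ffunP => B; rewrite !ffunE (bigD1 B) //= big1 => [|A /negPf AB].
  rewrite !ffunE eqxx mnmBB mpolyX0; case: ifP => _; last first.
    by rewrite scale0r mul0r addr0.
  by rewrite scale1r mul1r addr0.
by rewrite !ffunE eq_sym AB; case: ifP => _; rewrite scale0r mul0r.
Qed.

Lemma lift_bd f B : mlift (@bd K T) f B =
  \sum_(v | v \notin B) (sgn K B v *: 'X_[ell (v |: B) - ell B] : S) * (f (v |: B) : S).
Proof.
rewrite ffunE.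
under eq_bigr => A _ do rewrite ffunE scaler_suml mulr_suml.
rewrite exchange_big /=; apply: eq_bigr => v vB.
rewrite (bigD1 (v |: B)) //= big1 => [|A /negPf AB].
  by rewrite ffunE eqxx mulr1 addr0.
by rewrite ffunE eq_sym AB mulr0 scale0r mul0r.
Qed.

Lemma filtered_bd : filtered (@bd K T).
Proof.
move=> u c; apply: supp_bd => A v _; apply: lepm_trans.
exact/ell_mono/subsetUr.
Qed.

Lemma filtered_restr P : filtered (restr P).
Proof. by move=> u c sc A nA; rewrite ffunE sc //; case: ifP. Qed.

Definition mhom u (c : C) : F := [ffun A => c A *: 'X_[u - ell A] : S].

Lemma comp_hom w u c : lesupp u c -> mcomp w (mhom u c) = if w == u then c else 0.
Proof.
move=> sc; apply/ffunP => A; rewrite !ffunE mcoeffZ mcoeffX.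
have [z|/(supp_mem sc) Au] := eqVneq (c A) 0.
  by rewrite z mul0r; case: ifP; case: eqP => //; rewrite ?z ?ffunE.
case: ifPn => Aw; last first.
  by case: eqP => [wu|]; rewrite ?ffunE //; case/negP: Aw; rewrite wu.
case: eqVneq => [e|ne]; case: eqP => [wu|nwu]; rewrite ?mulr1 ?mulr0 ?ffunE //.
  by case: nwu; rewrite -(submK Aw) -(submK Au) e.
by case/eqP: ne; rewrite wu.
Qed.

(** * Subcomplexes cut out by homogenized idempotents *)

Section Complex.
Variable phi : nat -> {linear C -> C}.
Hypothesis phi_filt : forall i, filtered (phi i).
Hypothesis phi_idem : forall i c, phi i (phi i c) = phi i c.
Hypothesis phi_bd : forall i c, phi i (bd (phi i.+1 c)) = bd (phi i.+1 c).

(** The image of the idempotent is encoded as the kernel of its complement, which provides the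
    module structure; it is a retract of a free module. *)
Definition Tdef i : {linear F -> F} := idfun \- mlift (phi i).
Definition Tm i : lmodType S := ker (Tdef i).

Lemma lift_idem i x : Tdef i (mlift (phi i) x) = 0.
Proof.
by apply: comp_inj => u; rewrite compB comp0 !comp_lift //= phi_idem subrr.
Qed.

Definition Tproj i : {linear F -> Tm i} := corestr (@lift_idem i).

Lemma Tm_val i (x : Tm i) : mlift (phi i) (val x) = val x.
Proof. by have /eqP := ker_eq0 x; rewrite /= subr_eq0 => /eqP. Qed.

Lemma TprojK i : cancel (val : Tm i -> F) (@Tproj i).
Proof. by move=> x; apply: val_inj; rewrite /= Tm_val. Qed.

Lemma Tm_projective i : projective (Tm i).
Proof.
apply: (@retract_projective _ (Tm i) F (val : {linear ker (Tdef i) -> F}) (Tproj i)).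
  exact: TprojK.
exact: free_projective.
Qed.

Lemma Tm_comp i (x : Tm i) u : phi i (mcomp u (val x)) = mcomp u (val x).
Proof. by rewrite -comp_lift // Tm_val. Qed.

Lemma Td_subproof i (x : Tm i.+1) : Tdef i (mlift (@bd K T) (val x)) = 0.
Proof.
apply: comp_inj => u; rewrite compB comp0 !comp_lift //=; try exact: filtered_bd.
by rewrite -(Tm_comp x) phi_bd subrr.
Qed.

Definition Td i : {linear Tm i.+1 -> Tm i} :=
  corestr (g := mlift (@bd K T) \o val) (@Td_subproof i).

Lemma Td_val i x : val (Td i x) = mlift (@bd K T) (val x).
Proof. by []. Qed.

Lemma lift_bd_bd f : mlift (@bd K T) (mlift (@bd K T) f) = 0.
Proof.
apply: comp_inj => u; rewrite !comp_lift; try exact: filtered_bd.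
by rewrite /= bd_bd comp0.
Qed.

Lemma Tm_exact i :
  (forall u (c : C), lesupp u c -> phi i.+1 c = c -> bd c = 0 ->
     exists b, [/\ lesupp u b, phi i.+2 b = b & bd b = c]) ->
  forall x, Td i x = 0 <-> exists y, Td i.+1 y = x.
Proof.
move=> ex x; split=> [/(congr1 val)|[y <-]]; last first.
  by apply: val_inj; rewrite !Td_val lift_bd_bd.
rewrite Td_val => dx.
have hb u : {b : C | [/\ lesupp u b, phi i.+2 b = b & bd b = mcomp u (val x)]}.
  apply: constructive_indefinite_description; apply: ex => //.
  - exact: lesupp_comp.
  - exact: Tm_comp.
  - by rewrite -comp_lift ?dx ?comp0 //; apply: filtered_bd.
(* Only finitely many multidegrees occur in x; the fillings chosen in these are homogenized and
   summed. *)
pose U := undup (flatten [seq [seq (m + ell A)%MM | m <- msupp (val x A : S)]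
  | A <- enum {set T}]).
have xU u : u \notin U -> mcomp u (val x) = 0.
  move=> nuU; apply/ffunP => A; rewrite !ffunE; case: ifP => // Au.
  apply: memN_msupp_eq0; apply: contra nuU => mu; rewrite mem_undup; apply/flatten_mapP.
  by exists A; rewrite ?mem_enum //; apply/mapP; exists (u - ell A)%MM; rewrite ?submK.
pose y : F := \sum_(u <- U) mhom u (sval (hb u)).
have ycomp u : mcomp u y = if u \in U then sval (hb u) else 0.
  rewrite comp_sum; have [uU|nuU] := boolP (u \in U).
    rewrite (bigD1_seq u) ?undup_uniq //= comp_hom ?eqxx; last by case: (svalP (hb u)).
    rewrite big1 ?addr0 // => w /negPf nw; rewrite comp_hom 1?eq_sym ?nw //.
    by case: (svalP (hb w)).
  rewrite big_seq big1 // => w wU; rewrite comp_hom; last by case: (svalP (hb w)).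
  by case: eqP => // uw; rewrite uw wU in nuU.
have yT : Tdef i.+2 y = 0.
  apply: comp_inj => u; rewrite compB comp0 comp_lift //= ycomp.
  case: ifP => _; last by rewrite linear0 subrr.
  by case: (svalP (hb u)) => _ -> _; rewrite subrr.
exists (Ker (introT eqP yT)); apply: val_inj; rewrite Td_val /=.
apply: comp_inj => u; rewrite comp_lift; last exact: filtered_bd.
rewrite ycomp; case: ifPn => [_|/xU ->]; last by rewrite linear0.
by case: (svalP (hb u)).
Qed.

End Complex.

End Taylor.

(** * Resolutions and the homology of Gamma *)

Section Resolutions.
Variables (K : fieldType) (n : nat) (T : finType) (V : {set T}).
Variable g : T -> 'X_{1..n}.
Local Notation C := {ffun {set T} -> K^o}.
Local Notation S := {mpoly K[n]}.
Local Notation F := {ffun {set T} -> S^o}.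
Local Notation ell := (ell g).
Local Notation cl := (ell_cl V g).
Hypothesis g_neq0 : forall v, v \in V -> g v != 0%MM.
Hypothesis g_anti : {in V &, forall u v, (g u <= g v)%MM -> u = v}.

Let hcl : closure_op V cl := ell_closure g_neq0 g_anti.

Variables (M : lmodType S) (pi : {linear S^o -> M}).
Hypothesis surj_pi : surj pi.
Hypothesis ker_pi : forall r : S^o, pi r = 0 <->
  exists c : T -> S, r = \sum_(v in V) c v * 'X_[g v].

Definition tphi i : {linear C -> C} := restr (in_size V i).

Lemma eq_lift (phi phi' : C -> C) (f : F) : phi =1 phi' ->
  mlift g phi f = mlift g phi' f.
Proof.
by move=> e; apply/ffunP => B; rewrite !ffunE; apply: eq_bigr => A _; rewrite e.
Qed.

Lemma tphi_filt i : filtered g (tphi i).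
Proof. exact: filtered_restr. Qed.

Lemma tphiP i c : tphi i c = c <-> supp (in_size V i) c.
Proof.
split=> [<-|]; last exact: restr_supp.
by move=> A nA; rewrite ffunE (negPf nA).
Qed.

Lemma tphi_idem i c : tphi i (tphi i c) = tphi i c.
Proof. by apply/tphiP => A nA; rewrite ffunE (negPf nA). Qed.

Lemma tphi_bd i c : tphi i (bd (tphi i.+1 c)) = bd (tphi i.+1 c).
Proof. by apply/tphiP/supp_bd_size/tphiP/tphi_idem. Qed.

Definition ev0 (f : F) : S^o := f set0.

Lemma ev0_is_linear : linear ev0.
Proof. by move=> a f f'; rewrite /ev0 !ffunE. Qed.
HB.instance Definition _ := GRing.isLinear.Build S F S^o *:%R ev0 ev0_is_linear.

Section Augmented.
Variable psi : nat -> {linear C -> C}.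
Hypothesis psi_filt : forall i, filtered g (psi i).
Hypothesis psi_idem : forall i c, psi i (psi i c) = psi i c.
Hypothesis psi_bd : forall i c, psi i (bd (psi i.+1 c)) = bd (psi i.+1 c).
Hypothesis psi0 : psi 0%N =1 tphi 0%N.
(** In degree 1 only boundaries are compared: truncation at q = 1 changes [psi 1] by cycles, and the
    image in degree 0 is still the ideal. *)
Hypothesis bd_psi1 : forall c, bd (psi 1%N c) = bd (tphi 1%N c).
Hypothesis tphi_psi1 : forall c, tphi 1%N (psi 1%N c) = psi 1%N c.
Hypothesis psi_exact : forall i u (c : C), lesupp g u c ->
  psi i.+1 c = c -> bd c = 0 ->
  exists b, [/\ lesupp g u b, psi i.+2 b = b & bd b = c].

Local Notation P := (Tm g psi).
Local Notation d := (Td psi_filt psi_bd).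

Definition augm : {linear P 0%N -> M} :=
  pi \o (ev0 \o (val : {linear ker (Tdef g psi 0%N) -> F})).

Lemma augm_surj : surj augm.
Proof.
move=> y; have [r <-] := surj_pi y.
exists (Tproj psi_filt psi_idem 0%N [ffun=> r]) => /=.
by rewrite /ev0 (eq_lift _ psi0) lift_restr !ffunE /in_size sub0set cards0.
Qed.

Lemma augm_exact x : augm x = 0 <-> exists y, d 0%N y = x.
Proof.
split=> [/= /ker_pi[c xc]|[y <-]]; last first.
  have yV : mlift g (tphi 1%N) (val y) = val y.
    apply: (comp_inj (g := g)) => u; rewrite comp_lift; last exact: filtered_restr.
    by rewrite -(Tm_comp psi_filt) tphi_psi1.
  apply/ker_pi; exists (fun v => sgn K set0 v *: (val y [set v] : S)).
  rewrite /= /ev0 lift_bd [LHS](bigID [pred v | v \in V]) /=.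
  rewrite [X in _ + X]big1 ?addr0 => [|v /andP[_ vV]].
    apply: eq_big => [v|v /andP[_ vV]]; first by rewrite inE.
    by rewrite setU0 ell0 subm0 ell1 -!scalerAl mulrC.
  by rewrite setU0 -yV lift_restr ffunE /in_size sub1set (negPf vV) mulr0.
(* The coefficients of the relation are placed on the one-vertex faces; the sum has at most one
   term. *)
pose f : F := [ffun A => \sum_(v in V | A == [set v]) c v].
pose y0 := mlift g (tphi 1%N) f.
have Dy0 : mlift g (@bd K T) y0 = val x.
  apply/ffunP => B; rewrite lift_bd.
  have [->|B0] := eqVneq B set0; last first.
    rewrite -(Tm_val x) (eq_lift _ psi0) lift_restr ffunE /in_size.
    rewrite cards_eq0 (negPf B0) andbF big1 // => v vB.
    rewrite /y0 lift_restr ffunE /in_size cardsU1 vB eqSS cards_eq0 (negPf B0).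
    by rewrite andbF mulr0.
  rewrite [RHS]xc [LHS](bigID [pred v | v \in V]) /=.
  rewrite [X in _ + X]big1 ?addr0 => [|v /andP[_ vV]]; last first.
    by rewrite setU0 /y0 lift_restr ffunE /in_size sub1set (negPf vV) mulr0.
  apply: eq_big => [v|v /andP[_ vV]]; first by rewrite inE.
  rewrite setU0 ell0 subm0 ell1 /y0 lift_restr ffunE /in_size sub1set vV cards1 /=.
  rewrite ffunE (bigD1 v) /=; last by rewrite vV eqxx.
  rewrite big1 ?addr0 => [|u /andP[/andP[_ /eqP/set1_inj->]]]; last by rewrite eqxx.
  by rewrite /sgn (_ : [set _ in _ | _] = set0) ?cards0 ?expr0 ?scale1r 1?mulrC //;
     apply/setP => u; rewrite !inE.
exists (Tproj psi_filt psi_idem 1%N y0); apply: val_inj; rewrite Td_val /= -Dy0.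
apply: (comp_inj (g := g)) => u; rewrite !comp_lift //;
  try exact: filtered_bd; try exact: filtered_restr.
by rewrite [LHS]/= bd_psi1 tphi_idem.
Qed.

Lemma psi_complex_exact i x : d i x = 0 <-> exists y, d i.+1 y = x.
Proof. exact: (Tm_exact psi_filt psi_bd (psi_exact (i := i))). Qed.

Lemma psi_resolution q : (forall i c, (q < i)%N -> psi i c = 0) ->
  has_proj_resolution M q.
Proof.
move=> psi_gt; exists P, d, augm; split.
- by move=> i; apply: Tm_projective.
- move=> i qi x; apply: val_inj; apply: (comp_inj (g := g)) => u.
  by rewrite -(Tm_comp psi_filt) psi_gt // comp0.
- exact: augm_surj.
- exact: augm_exact.
- exact: psi_complex_exact.
Qed.

End Augmented.

Lemma tphi_exact i u (c : C) : lesupp g u c ->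
  tphi i.+1 c = c -> bd c = 0 ->
  exists b, [/\ lesupp g u b, tphi i.+2 b = b & bd b = c].
Proof.
move=> uc /tphiP sc zc; pose m := [set v in V | (g v <= u)%MM].
have sm (A : {set T}) : (A \subset m) = (A \subset V) && (ell A <= u)%MM.
  rewrite ell_le; apply/subsetP/andP => [h|[/subsetP h /forall_inP h'] v vA].
    by split; [apply/subsetP|apply/forall_inP] => v /h; rewrite inE => /andP[].
  by rewrite inE h // h'.
have mc : supp (in_size m i.+1) c.
  move=> A; rewrite /in_size sm -andbA => /nandP[nAV|/nandP[nAu|nA]].
  - by apply: sc; rewrite /in_size (negPf nAV).
  - exact: uc.
  - by apply: sc; rewrite /in_size (negPf nA) andbF.
have [m0|/simplex_exact/(_ mc zc)[b [sb bc]]] := eqVneq m set0.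
  exists 0; rewrite !linear0; split=> //; first exact: supp0.
  symmetry; apply: supp_eq0 mc _ => A; rewrite m0 /in_size subset0.
  by apply/andP => -[/eqP->]; rewrite cards0.
exists b; split=> //.
  by apply: supp_sub sb => A; rewrite /in_size sm => /andP[/andP[]].
by apply/tphiP; apply: supp_sub sb => A; rewrite /in_size sm => /andP[/andP[->]].
Qed.

(** * Truncation of the Taylor complex *)

Section Truncated.
Variable q : nat.
Hypothesis q_gt0 : (0 < q)%N.
Hypothesis Hq : forall m : {set T}, m \subset V -> cl m = m -> gam_exact K cl q m.

(** The Taylor module in degree q is the direct sum of its cycles and the image of [compl]. Keeping
    only the latter leaves the boundaries in degree q - 1 unchanged and makes the last differential
    injective. *)
Lemma truncated_resolution : has_proj_resolution M q.
Proof.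
have [rho [rho_cycle rho_id rho_supp]] := cycle_projector hcl Hq.
have tphi_rho c : tphi q (rho c) = rho c by apply/tphiP; case: (rho_cycle c).
have bd_rho c : bd (rho c) = 0 by case: (rho_cycle c).
have rho_filt : filtered g (rho \o tphi q).
  move=> u c uc /=.
  apply: (supp_sub (P := fun A => (A \subset V) && (ell A <= u)%MM)) => [A /andP[]//|].
  apply: rho_supp => [A B AV /andP[_ Au] BA|A].
    rewrite (subset_trans BA) ?ell_cl_sub //= (lepm_trans _ Au) //.
    by rewrite -(ell_cl_le (V := V)) // (subset_trans BA) ?ell_cl_sub.
  rewrite negb_and => /orP[nA|nA]; rewrite ffunE /in_size ?(negPf nA) //.
  by rewrite uc // if_same.
pose compl : {linear C -> C} := tphi q \- (rho \o tphi q).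
pose psi i : {linear C -> C} :=
  if (i < q)%N then tphi i else if i == q then compl else \0.
have psi_lt i : (i < q)%N -> psi i = tphi i by rewrite /psi => ->.
have psi_q c : psi q c = tphi q c - rho (tphi q c) by rewrite /psi ltnn eqxx.
have psi_gt i c : (q < i)%N -> psi i c = 0.
  by move=> lt; rewrite /psi ltnNge ltnW //= gtn_eqF.
have bd_psi i c : (i <= q)%N -> bd (psi i c) = bd (tphi i c).
  rewrite leq_eqVlt => /orP[/eqP->|/psi_lt->//].
  by rewrite psi_q linearB /= bd_rho subr0.
have tphi_psi i c : tphi i (psi i c) = psi i c.
  case: (ltngtP i q) => [/psi_lt->|/psi_gt->|->]; first exact: tphi_idem.
    exact: linear0.
  by rewrite psi_q linearB /= -/(tphi q) tphi_rho tphi_idem.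
have psi_filt i : filtered g (psi i).
  case: (ltngtP i q) => [/psi_lt->|lt|->]; first exact: tphi_filt.
    by move=> u c _; rewrite psi_gt //; apply: supp0.
  by move=> u c uc; rewrite psi_q; apply: suppB; [apply: tphi_filt | apply: rho_filt].
have psi_idem i c : psi i (psi i c) = psi i c.
  case: (ltngtP i q) => [/psi_lt->|lt|->]; first exact: tphi_idem.
    by rewrite !psi_gt.
  rewrite [LHS]psi_q tphi_psi psi_q linearB /=.
  by rewrite (rho_id (rho _)) // subrr subr0.
have psi_bd i c : psi i (bd (psi i.+1 c)) = bd (psi i.+1 c).
  case: (ltnP i q) => [lt|le]; last by rewrite [psi i.+1 c]psi_gt // !linear0.
  by rewrite bd_psi // psi_lt // tphi_bd.
apply: (psi_resolution psi_filt psi_idem psi_bd _ _ _ _ psi_gt).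
- by move=> c; rewrite psi_lt.
- by move=> c; apply: bd_psi.
- by move=> c; apply: tphi_psi.
move=> i u c uc psic zc; have tc : tphi i.+1 c = c by rewrite -psic tphi_psi.
case: (ltngtP i.+1 q) => [lt|lt|eq_iq].
- have [b [ub tb bc]] := tphi_exact uc tc zc.
  exists (psi i.+2 b); split; [exact: psi_filt | exact: psi_idem |].
  by rewrite bd_psi // tb.
- exists 0; rewrite !linear0 -psic psi_gt //; split=> //; exact: supp0.
(* In degree q a cycle is fixed by [rho], hence killed by [psi q]. *)
- exists 0; rewrite !linear0 -psic eq_iq psi_q; split=> //; first exact: supp0.
  rewrite -eq_iq tc rho_id ?subrr //; split=> //.
  by rewrite -eq_iq; apply/tphiP.
Qed.

End Truncated.

(** * Reduction of the Taylor complex modulo the variables *)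

Definition const_part (f : F) : C := [ffun A => (f A : S)@_0].

(** A facet contributes only if it has the same lcm, since otherwise its coefficient is a
    nonconstant monomial. *)
Lemma const_part_lift_bd (f : F) (B : {set T}) :
  const_part (mlift g (@bd K T) f) B =
  \sum_(v | v \notin B) (if (ell (v |: B) <= ell B)%MM
                         then sgn K B v * const_part f (v |: B) else 0).
Proof.
rewrite ffunE lift_bd raddf_sum; apply: eq_bigr => v _ /=.
rewrite -scalerAl mcoeffZ mcoeffXM ffunE.
have -> : (ell (v |: B) - ell B <= 0)%MM = (ell (v |: B) <= ell B)%MM.
  by apply/mnm_lepP/mnm_lepP => h i; move: (h i); rewrite mnmBE mnm0E leqn0 subn_eq0.
case: ifP => _; rewrite ?mulr0 //; congr (_ * _@_ _).
by apply/mnmP => i; rewrite mnmBE mnm0E sub0n.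
Qed.

(** An S-linear map preserves the vectors with all coefficients in the ideal of the variables. *)
Lemma const_part_linear (h : {linear F -> F}) (f : F) :
  const_part f = 0 -> const_part (h f) = 0.
Proof.
move=> f0; have z A : (f A : S)@_0 = 0.
  by have /(congr1 (fun c : C => c A)) := f0; rewrite [LHS]ffunE [RHS]ffunE.
apply/ffunP => B; rewrite {1}(ffun_sum_delta f) linear_sum [LHS]ffunE [RHS]ffunE.
rewrite sum_ffunE raddf_sum big1 //= => A _.
by rewrite linearZ ffunE /GRing.scale /= rmorphM /= z mul0r.
Qed.

(** Tor_{k+1} in the multidegree of m is the homology of the simplex on m relative to Gamma_m. The
    contraction of the Taylor complex, reduced modulo the variables, kills every such relative
    cycle. *)
Lemma gam_exact_of_resolution q : has_proj_resolution M q ->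
  forall m : {set T}, m \subset V -> cl m = m ->
  forall k, (q <= k)%N -> gam_exact K cl k m.
Proof.
move=> res m mV clm k qk c sc zc.
have [s hs] := resolution_contraction (Tm_projective tphi_filt tphi_idem)
  (augm_surj tphi_filt tphi_idem (fun=> erefl))
  (augm_exact tphi_filt tphi_idem tphi_bd (fun=> erefl) (fun=> erefl) (tphi_idem 1%N))
  (psi_complex_exact tphi_filt tphi_bd tphi_exact) res.
have [m0|m0] := eqVneq m set0.
  exists 0; rewrite linear0; split; first exact: supp0.
  symmetry; apply: supp_eq0 sc _ => A; apply/and3P => -[].
  by rewrite m0 subset0 => /eqP->; rewrite -m0 clm eqxx.
have [b [sb bc]] := simplex_exact m0 (supp_sub (@gam_in_size _ cl m k) sc) zc.
(* The part of the filling outside Gamma_m is the relative cycle that corresponds to c. *)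
pose b' : C := restr [pred A | cl A == m] b.
have sb' : supp (in_size m k.+1) b' by move=> A nA; rewrite ffunE sb // if_same.
have VS (A : {set T}) j : in_size m j A -> A \subset V.
  by case/andP=> Am _; apply: subset_trans mV.
pose X : F := [ffun A => (b' A)%:MP].
have XT : Tdef g tphi k.+1 X = 0.
  rewrite /Tdef /= lift_restr; apply/eqP; rewrite subr_eq0; apply/eqP/ffunP => A.
  rewrite !ffunE /in_size; case: ifPn => //; case: ifPn => // nA _.
  rewrite sb // /in_size; apply: contra nA => /andP[Am ->].
  by rewrite (subset_trans Am).
pose x : Tm g tphi k.+1 := Ker (introT eqP XT).
pose dx := Td tphi_filt tphi_bd k x.
have ct_x : const_part X = b'.
  by apply/ffunP => A; rewrite !ffunE mcoeffC eqxx mulr1.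
have ell_clE (A B : {set T}) : A \subset B -> B \subset V ->
    (ell B <= ell A)%MM = (cl B == cl A).
  move=> AB BV; have AV := subset_trans AB BV; rewrite -(ell_cl_le (V := V)) //.
  rewrite eqEsubset (cl_mono hcl AB BV) andbT; apply/idP/idP => [|h].
    exact: (cl_min hcl).
  exact: subset_trans (cl_ext hcl BV) h.
have bd_b' : supp (gam cl m k) (bd b').
  move=> A nA; have [clA|nclA] := eqVneq (cl A) m; last first.
    move: nA; rewrite /gam nclA /= => nA; exact: (supp_bd_size sb').
  case: (boolP (in_size m k A)) => [sA|]; last exact: (supp_bd_size sb').
  transitivity (bd b A); last first.
    by rewrite bc; apply: sc; rewrite /gam clA eqxx andbF.
  rewrite !ffunE; apply: eq_bigr => v vA; rewrite ffunE /=; case: eqP => // nvA.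
  have [->//|/(supp_mem sb) svA] := eqVneq (b (v |: A)) 0.
  case: nvA; apply/eqP; rewrite eqEsubset -{1}clm (cl_mono hcl) //=; last first.
    by case/andP: svA.
  by rewrite -clA (cl_mono hcl) ?subsetUr ?(VS _ _ svA).
(* At sets with closure m the boundary of [b'] cancels; at all others it carries a nonconstant
   monomial. *)
have ct_dx : const_part (val dx) = 0.
  apply/ffunP => A; rewrite Td_val const_part_lift_bd ct_x ffunE.
  have [clA|nclA] := eqVneq (cl A) m.
    transitivity (bd b' A); last by apply: bd_b'; rewrite /gam clA eqxx andbF.
    rewrite ffunE; apply: eq_bigr => v vA; case: ifPn => // nle.
    have [->|nz] := eqVneq (b' (v |: A)) 0; first by rewrite mulr0.
    case/negP: nle; have vAV := VS _ _ (supp_mem sb' nz).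
    rewrite ell_clE ?subsetUr // clA.
    by move: nz; rewrite ffunE /=; case: ifP => //; rewrite eqxx.
  rewrite big1 // => v vA; case: ifP => // le.
  have [->|nz] := eqVneq (b' (v |: A)) 0; first by rewrite mulr0.
  case/eqP: nclA; move: le; rewrite ell_clE ?subsetUr ?(VS _ _ (supp_mem sb' nz)) //.
  by move=> /eqP <-; move: nz; rewrite ffunE /=; case: (_ =P m) => // _; rewrite eqxx.
have ct_sdx : const_part (val (s k dx)) = 0.
  pose h : {linear F -> F} :=
    (val : {linear ker (Tdef g tphi k.+1) -> F})
      \o (s k \o Tproj tphi_filt tphi_idem k).
  have <- : h (val dx) = val (s k dx).
    by rewrite -[in RHS](TprojK tphi_filt tphi_idem dx).
  exact: const_part_linear.
pose y := val (s k.+1 x); pose w0 := const_part y.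
have sw0 : supp (in_size V k.+2) w0.
  move=> A nA; rewrite ffunE /y -(Tm_val (s k.+1 x)) lift_restr ffunE (negPf nA).
  exact: mcoeff0.
(* Here X = d(sX) + s(dX), and the last term vanishes modulo the variables. *)
have b'E A : b' A = const_part (mlift g (@bd K T) y) A.
  have e : X = mlift g (@bd K T) y + val (s k dx).
    by have /(congr1 val) := hs k qk x; rewrite raddfD.
  rewrite -ct_x {1}e.
  transitivity (const_part (mlift g (@bd K T) y) A + const_part (val (s k dx)) A).
    by rewrite ![const_part _ _]ffunE [((_ + _) : F) A]ffunE mcoeffD.
  by rewrite ct_sdx [(0 : C) A]ffunE addr0.
pose w : C := restr [pred A | cl A == m] w0.
have sw : supp (in_size m k.+2) w.
  move=> A; rewrite ffunE /=; case: (_ =P m) => // clA nA; apply: sw0.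
  apply: contra nA => /andP[AV szA]; rewrite /in_size szA andbT -clA.
  exact: (cl_ext hcl).
(* [bd w] agrees with b on the sets with closure m, so the difference is a filling inside
   Gamma_m. *)
exists (b - bd w); split; last by rewrite linearB /= bd_bd subr0.
have s_m : supp (in_size m k.+1) (b - bd w) by apply: suppB => //; apply: supp_bd_size.
move=> A; have [sA|/s_m //] := boolP (in_size m k.+1 A).
have /andP[Am szA] := sA; rewrite /gam Am szA andbT negbK /= => /eqP clA.
rewrite !ffunE (_ : b A = b' A); last by rewrite ffunE /= clA eqxx.
apply/eqP; rewrite subr_eq0 b'E const_part_lift_bd; apply/eqP.
apply: eq_bigr => v vA; have [z|/(supp_mem sw0)/andP[vAV _]] := eqVneq (w0 (v |: A)) 0.
  by rewrite -/w0 [w _]ffunE z if_same !mulr0 if_same.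
by rewrite ell_clE ?subsetUr // clA [w _]ffunE /= -/w0; case: ifP => _; rewrite ?mulr0.
Qed.

End Resolutions.

(** * Quotient modules and lattices of closed sets *)

Section QuotientModule.
Variables (S : comNzRingType) (I : S -> Prop).
Hypotheses (I0 : I 0) (IB : forall x y, I x -> I y -> I (x - y)).
Hypothesis IM : forall a x, I x -> I (a * x).
Local Open Scope quotient_scope.

(** The quotient construction takes a boolean predicate, so membership in the ideal is decided
    classically. *)
Definition idealb : {pred S} :=
  fun x => if excluded_middle_informative (I x) then true else false.

Lemma idealbP x : reflect (I x) (x \in idealb).
Proof.
by rewrite unfold_in /idealb; case: excluded_middle_informative; constructor.
Qed.

Lemma idealb_zmod_closed : zmod_closed idealb.
Proof.
by split=> [|x y /idealbP Ix /idealbP Iy]; apply/idealbP; [exact: I0 | exact: IB].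
Qed.
HB.instance Definition _ := GRing.isZmodClosed.Build S idealb idealb_zmod_closed.

Definition quotm : Type := Quotient.quot idealb.
HB.instance Definition _ := GRing.Zmodule.on quotm.

Definition proj_quotm (x : S^o) : quotm := \pi_(Quotient.quot idealb) x.

Lemma proj_quotm_eq x y : proj_quotm x = proj_quotm y <-> I (x - y).
Proof.
have e := Quotient.idealrBE idealb x y.
by split=> [h|/idealbP]; [apply/idealbP; rewrite e; apply/eqP | rewrite e => /eqP].
Qed.

Lemma proj_quotmB : {morph proj_quotm : x y / x - y}.
Proof. by move=> x y; rewrite /proj_quotm !piE. Qed.

Definition scale_quotm (a : S) (x : quotm) : quotm :=
  proj_quotm (a * repr (x : Quotient.quot idealb)).

Lemma scale_proj a x : scale_quotm a (proj_quotm x) = proj_quotm (a * x).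
Proof.
apply/proj_quotm_eq; rewrite -mulrBr; apply/IM/proj_quotm_eq.
by rewrite /proj_quotm reprK.
Qed.

Lemma proj_quotm_surj (y : quotm) : exists x, proj_quotm x = y.
Proof. by exists (repr (y : Quotient.quot idealb)); apply: reprK. Qed.

Lemma proj_quotm0 : proj_quotm 0 = 0.
Proof. by rewrite -(subrr 0) proj_quotmB subrr. Qed.

Lemma proj_quotmD : {morph proj_quotm : x y / x + y}.
Proof.
move=> x y; rewrite -{1}[y]opprK proj_quotmB -[- y]sub0r proj_quotmB proj_quotm0.
by rewrite sub0r opprK.
Qed.

Lemma scale_quotmA a b x : scale_quotm a (scale_quotm b x) = scale_quotm (a * b) x.
Proof. by have [r <-] := proj_quotm_surj x; rewrite !scale_proj mulrA. Qed.

Lemma scale_quotm1 : left_id 1 scale_quotm.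
Proof. by move=> x; have [r <-] := proj_quotm_surj x; rewrite scale_proj mul1r. Qed.

Lemma scale_quotmDr : right_distributive scale_quotm +%R.
Proof.
move=> a x y; have [r <-] := proj_quotm_surj x; have [s <-] := proj_quotm_surj y.
by rewrite -proj_quotmD !scale_proj mulrDr proj_quotmD.
Qed.

Lemma scale_quotmDl x : {morph scale_quotm^~ x : a b / a + b}.
Proof.
by move=> a b; have [r <-] := proj_quotm_surj x; rewrite !scale_proj mulrDl proj_quotmD.
Qed.

HB.instance Definition _ := GRing.Zmodule_isLmodule.Build S quotm
  scale_quotmA scale_quotm1 scale_quotmDr scale_quotmDl.

Lemma proj_quotm_is_linear : linear proj_quotm.
Proof. by move=> a x y; rewrite proj_quotmD -scale_proj. Qed.
HB.instance Definition _ :=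
  GRing.isLinear.Build S S^o quotm *:%R proj_quotm proj_quotm_is_linear.

Lemma quotient_exists : exists M : lmodType S, is_quotient I M.
Proof.
exists quotm, proj_quotm; split=> [|r]; first exact: proj_quotm_surj.
by rewrite -[X in _ <-> I X]subr0 -proj_quotm_eq proj_quotm0.
Qed.

End QuotientModule.

Section SetJoin.
Variables (d : Order.disp_t) (L : finTBLatticeType d).

Lemma set_joinP (A : {set L}) (x : L) :
  reflect (forall a, a \in A -> (a <= x)%O) (set_join A <= x)%O.
Proof. exact: joinsP. Qed.

Lemma le_set_join (A : {set L}) a : a \in A -> (a <= set_join A)%O.
Proof. by move: a; apply/set_joinP; apply: lexx. Qed.

Lemma set_join_mono (A B : {set L}) : A \subset B -> (set_join A <= set_join B)%O.
Proof. by move=> /subsetP AB; apply/set_joinP => a /AB; apply: le_set_join. Qed.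

Lemma set_joinU (A B : {set L}) :
  set_join (A :|: B) = (set_join A `|` set_join B)%O.
Proof.
apply/le_anti/andP; split; last by rewrite leUx !set_join_mono ?subsetUl ?subsetUr.
apply/set_joinP => a; rewrite inE => /orP[] /le_set_join aA.
  exact: le_trans aA (leUl _ _).
exact: le_trans aA (leUr _ _).
Qed.

End SetJoin.

(** * The lattice of closed sets *)

Fact clat_display : Order.disp_t. Proof. exact: Order.Disp tt tt. Qed.

Section ClosureLattice.
Variables (T : finType) (V : {set T}) (cl : {set T} -> {set T}).

Record clat (hcl : closure_op V cl) := Clat { cset : {set T}; _ : closed_in V cl cset }.

Variable hcl : closure_op V cl.
Local Notation L := (clat hcl).

HB.instance Definition _ := [isSub for @cset hcl].
HB.instance Definition _ := [Finite of L by <:].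

Lemma cset_subV (x : L) : cset x \subset V.
Proof. by case: x => X /= /andP[]. Qed.

Lemma cl_cset (x : L) : cl (cset x) = cset x.
Proof. by case: x => X /= /andP[_ /eqP]. Qed.

Lemma closed_in_cl (A : {set T}) : closed_in V cl (cl (A :&: V)).
Proof. by rewrite /closed_in (cl_sub hcl) ?(cl_idem hcl) ?subsetIr // eqxx. Qed.

Definition cmk (A : {set T}) : L := Clat hcl (closed_in_cl A).

Lemma cset_cmk (A : {set T}) : A \subset V -> cset (cmk A) = cl A.
Proof. by move=> AV; rewrite /= (setIidPl AV). Qed.

Definition cle (x y : L) := cset x \subset cset y.
Lemma cle_refl : reflexive cle. Proof. by move=> x; apply: subxx. Qed.
Lemma cle_anti : antisymmetric cle.
Proof. by move=> x y h; apply: val_inj; apply/eqP; rewrite eqEsubset. Qed.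
Lemma cle_trans : transitive cle. Proof. by move=> y x z; apply: subset_trans. Qed.
HB.instance Definition _ :=
  Order.Le_isPOrder.Build clat_display L cle_refl cle_anti cle_trans.

Lemma cle_cmk (A : {set T}) (x : L) : A \subset V ->
  (cmk A <= x)%O = (A \subset cset x).
Proof.
move=> AV; rewrite /Order.le /= /cle cset_cmk //; apply/idP/idP.
  exact: subset_trans (cl_ext hcl AV).
by move=> h; have := cl_mono hcl h (cset_subV x); rewrite cl_cset.
Qed.

Definition cmeet (x y : L) : L := cmk (cset x :&: cset y).
Definition cjoin (x y : L) : L := cmk (cset x :|: cset y).

Lemma cset_meet x y : cset (cmeet x y) = cset x :&: cset y.
Proof.
have sV : cset x :&: cset y \subset V.
  by apply: subset_trans (subsetIl _ _) (cset_subV x).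
rewrite cset_cmk //; apply/eqP; rewrite eqEsubset (cl_ext hcl) // andbT subsetI.
rewrite -{2}(cl_cset x) -{3}(cl_cset y).
by rewrite !(cl_mono hcl) ?subsetIl ?subsetIr ?cset_subV.
Qed.

Lemma cmeetP x y z : (x <= cmeet y z)%O = (x <= y)%O && (x <= z)%O.
Proof. by rewrite {1}/Order.le /= /cle cset_meet subsetI. Qed.

Lemma cjoinP x y z : (cjoin x y <= z)%O = (x <= z)%O && (y <= z)%O.
Proof. by rewrite cle_cmk ?subUset ?cset_subV. Qed.

HB.instance Definition _ :=
  Order.POrder_MeetJoin_isLattice.Build clat_display L cmeetP cjoinP.

Lemma cbot_le x : (cmk set0 <= x)%O.
Proof. by rewrite cle_cmk ?sub0set. Qed.
Lemma le_ctop x : (x <= cmk V)%O.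
Proof.
rewrite /Order.le /= /cle cset_cmk //.
exact: subset_trans (cset_subV x) (cl_ext hcl (subxx V)).
Qed.
HB.instance Definition _ := Order.hasBottom.Build clat_display L cbot_le.
HB.instance Definition _ := Order.hasTop.Build clat_display L le_ctop.

Definition clattice : finTBLatticeType clat_display := L.

Lemma cset_bot : cset (\bot%O : L) = set0.
Proof. by rewrite cset_cmk ?sub0set // (cl_set0 hcl). Qed.

Lemma cset_cmk1 v : v \in V -> cset (cmk [set v]) = [set v].
Proof. by move=> vV; rewrite cset_cmk ?sub1set // (cl_set1 hcl). Qed.

Lemma cmk1_atom v : v \in V -> cmk [set v] \in atoms clattice.
Proof.
move=> vV; rewrite inE; apply/andP; split.
  apply/eqP => /(congr1 (@cset hcl)); rewrite cset_bot cset_cmk1 // => /setP/(_ v).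
  by rewrite !inE eqxx.
apply/forallP => x; apply/implyP; rewrite lt_neqAle => /andP[nx].
rewrite {1}/Order.le /= /cle cset_cmk1 // subset1 => /orP[] /eqP ex.
  by case/eqP: nx; apply: val_inj; rewrite [RHS]cset_cmk1.
by apply/eqP/val_inj; rewrite [RHS]cset_bot.
Qed.

Lemma atoms_clattice : atoms clattice = [set cmk [set v] | v in V].
Proof.
apply/setP => x; apply/idP/imsetP => [|[v vV ->]]; last exact: cmk1_atom.
rewrite inE => /andP[x0 /forallP hx].
have [x00|[v vx]] := set_0Vmem (cset x).
  by case/eqP: x0; apply: val_inj; rewrite [RHS]cset_bot.
have vV : v \in V by apply: (subsetP (cset_subV x)).
exists v => //; apply/eqP; apply: contraT => nx.
have := hx (cmk [set v]); rewrite lt_neqAle eq_sym nx cle_cmk ?sub1set // vx /=.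
by have := cmk1_atom vV; rewrite inE => /andP[/negPf ->].
Qed.

Lemma card_atoms_clattice : #|atoms clattice| = #|V|.
Proof.
rewrite atoms_clattice card_in_imset // => u v uV vV /(congr1 (@cset hcl)).
by rewrite !cset_cmk1 // => /set1_inj.
Qed.

Lemma clattice_atomistic : atomistic clattice.
Proof.
move=> x; exists [set cmk [set v] | v in cset x]; split.
  by rewrite atoms_clattice; apply/imsetS/cset_subV.
apply/le_anti/andP; split.
  rewrite {1}/Order.le /= /cle; apply/subsetP => v vx.
  have vV := subsetP (cset_subV x) _ vx.
  have : (cmk [set v] <= set_join [set cmk [set v] | v in cset x] :> clattice)%O.
    by apply: le_set_join; apply: imset_f.
  by rewrite cle_cmk ?sub1set.
apply/set_joinP => _ /imsetP[v vx ->].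
by rewrite cle_cmk ?sub1set //; apply: (subsetP (cset_subV x)).
Qed.

End ClosureLattice.

(** * Realization by monomial ideals *)

Lemma eq_gam_exact (K : fieldType) (T : finType) (V : {set T})
    (cl cl' : {set T} -> {set T}) n (m : {set T}) :
  (forall A : {set T}, A \subset V -> cl A = cl' A) -> m \subset V ->
  gam_exact K cl n m -> gam_exact K cl' n m.
Proof.
move=> e mV h; have eg k : gam cl m k =1 gam cl' m k.
  move=> A; rewrite /gam; case: (boolP (A \subset m)) => //= Am.
  by rewrite e // (subset_trans Am).
move=> c sc zc; have [|//|b [sb <-]] := h c; first by move=> A; rewrite eg; apply: sc.
by exists b; split=> // A; rewrite -eg; apply: sb.
Qed.

(** Gamma of an atom consists of the empty face alone and has homology there: Tor_1 is nonzero. *)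
Lemma not_gam_exact0 (K : fieldType) (T : finType) (V : {set T}) cl
    (hcl : closure_op V cl) v :
  v \in V -> ~ gam_exact K cl 0 [set v].
Proof.
move=> vV h; have [||b [sb bb]] := h (delta K set0).
- apply: supp_delta; rewrite /gam sub0set cards0 (cl_set0 hcl).
  by rewrite eq_sym -card_gt0 cards1.
- apply/ffunP => A; rewrite !ffunE big1 // => u uA; rewrite ffunE.
  by rewrite -cards_eq0 cardsU1 uA mulr0.
have b0 : b = 0.
  apply: supp_eq0 sb _ => A; apply/and3P => -[Av nA szA]; case/eqP: nA.
  have -> : A = [set v] by apply/eqP; rewrite eqEcard Av (eqP szA) cards1.
  exact: (cl_set1 hcl).
have /eqP := oner_neq0 K; apply.
have /(congr1 (fun c : {ffun {set T} -> K^o} => c set0)) := bb.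
by rewrite b0 linear0 !ffunE eqxx => /esym.
Qed.

Section Monomials.
Variables (n : nat) (T : finType) (V : {set T}) (g : T -> 'X_{1..n}).
Variable G : seq 'X_{1..n}.
Hypothesis Gg : G =i [seq g v | v <- enum V].

Lemma mem_gens m : reflect (exists2 v, v \in V & m = g v) (m \in G).
Proof.
rewrite Gg; apply: (iffP mapP) => -[v vV ->]; exists v => //.
  by rewrite mem_enum in vV.
by rewrite mem_enum.
Qed.

Lemma mlcms_le (s : seq 'X_{1..n}) u : (mlcms s <= u)%MM = all (fun m => (m <= u)%MM) s.
Proof.
elim: s => [|m s IH] /=; last by rewrite lem_mlcm IH.
by apply/mnm_lepP => i; rewrite mnm0E.
Qed.

Lemma in_lcm_latticeP m :
  in_lcm_lattice G m <-> exists2 A : {set T}, A \subset V & m = ell g A.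
Proof.
split=> [[s [sG ->]]|[A AV ->]].
  exists [set v in V | g v \in s]; first by apply/subsetP => v; rewrite inE => /andP[].
  apply: lem_anti; last first.
    rewrite ell_le; apply/forall_inP => v; rewrite inE => /andP[_ vs].
    by have := lepm_refl (mlcms s); rewrite mlcms_le => /allP; apply.
  rewrite mlcms_le; apply/allP => h hs; have /mem_gens[v vV hv] := sG _ hs.
  by rewrite hv; apply: lem_g; rewrite inE vV -hv.
exists [seq g v | v <- enum A]; split.
  move=> h /mapP[v]; rewrite mem_enum => /(subsetP AV) vV ->.
  by apply/mem_gens; exists v.
apply: lem_anti.
  rewrite ell_le; apply/forall_inP => v vA.
  have := lepm_refl (mlcms [seq g v | v <- enum A]); rewrite mlcms_le => /allP; apply.
  by apply: map_f; rewrite mem_enum.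
by rewrite mlcms_le; apply/allP => h /mapP[v]; rewrite mem_enum => vA ->; apply: lem_g.
Qed.

Lemma mon_idealP (K : fieldType) (r : {mpoly K[n]}) :
  uniq G -> {in V &, injective g} ->
  mon_ideal G r <-> exists c : T -> {mpoly K[n]}, r = \sum_(v in V) c v * 'X_[g v].
Proof.
move=> uG g_inj.
have pG : perm_eq G [seq g v | v <- enum V].
  apply: uniq_perm => //; rewrite map_inj_in_uniq ?enum_uniq // => u v.
  by rewrite !mem_enum; apply: g_inj.
split=> -[c ->].
  exists (fun v => c (g v)).
  by rewrite (perm_big _ pG) big_map big_enum.
exists (fun h => \sum_(v in V | g v == h) c v).
rewrite (perm_big _ pG) big_map big_enum /=; apply: eq_bigr => v vV.
rewrite (bigD1 v) /= ?vV ?eqxx // big1 ?addr0 // => u /andP[/andP[uV /eqP gu]].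
by rewrite (g_inj u v) ?eqxx.
Qed.

Lemma mon_ideal_closed (K : fieldType) :
  [/\ @mon_ideal K n G 0,
      forall r s, @mon_ideal K n G r -> mon_ideal G s -> mon_ideal G (r - s)
    & forall a r, @mon_ideal K n G r -> mon_ideal G (a * r)].
Proof.
split=> [|r s [c ->] [c' ->]|a r [c ->]].
- by exists (fun=> 0); rewrite big1 // => h _; rewrite mul0r.
- exists (fun h => c h - c' h); rewrite -sumrB; apply: eq_bigr => h _.
  by rewrite mulrBl.
- by exists (fun h => a * c h); rewrite mulr_sumr; apply: eq_bigr => h _; rewrite mulrA.
Qed.

End Monomials.

(** Passes from some resolution to one of least length, as [proj_dim] demands. *)
Lemma ex_least (P : nat -> Prop) p : P p ->
  exists p', [/\ (p' <= p)%N, P p' & forall r, (r < p')%N -> ~ P r].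
Proof.
elim/ltn_ind: p => p IH Pp.
have [[r [rp Pr]]|h] := classic (exists r, (r < p)%N /\ P r).
  have [p' [p'r Pp' minp']] := IH r rp Pr.
  by exists p'; split=> //; apply: leq_trans p'r (ltnW rp).
by exists p; split=> // r rp Pr; apply: h; exists r.
Qed.

Section Realization.
Variables (K : fieldType) (T : finType) (V : {set T}) (cl : {set T} -> {set T}).
Hypothesis hcl : closure_op V cl.

(* One variable per set of vertices, so that the monomial of [v] records which
   closed sets avoid [v]. *)
Definition cmon (v : T) : 'X_{1..#|{set T}|} :=
  [multinom ((closed_in V cl (enum_val i) && (v \notin enum_val i)) : nat)
    | i < #|{set T}|].

Lemma cmon_le v (B : {set T}) : v \in V -> B \subset V ->
  (cmon v <= ell cmon B)%MM = (v \in cl B).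
Proof.
(* The variable of the closed set cl B does not occur in the lcm over B, so it does not occur in the
   monomial of v. *)
move=> vV BV; apply/idP/idP => [/mnm_lepP/(_ (enum_rank (cl B)))|vB].
  rewrite !mnmE enum_rankK /closed_in (cl_sub hcl) // (cl_idem hcl) // eqxx /=.
  rewrite big1 => [|w wB]; first by case: (v \in cl B).
  rewrite mnmE enum_rankK (_ : w \in cl B) ?andbF //.
  by apply: (subsetP (cl_ext hcl BV)).
(* A closed set X that avoids v in cl B cannot contain B, so some w of B also has the variable of
   X. *)
apply/mnm_lepP => i; rewrite !mnmE; set X := enum_val i.
case: (boolP (closed_in V cl X)) => //= /andP[XV /eqP clX].
case: (boolP (v \in X)) => //= vX.
have /subsetPn[w wB wX] : ~~ (B \subset X).
  apply: contra vX => BX; rewrite -clX; apply: (subsetP _ _ vB).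
  exact: (cl_mono hcl).
apply: leq_trans (leq_bigmax_cond (F := fun v => cmon v i) _ wB).
by rewrite mnmE -/X /closed_in XV clX eqxx wX.
Qed.

Lemma ell_cl_cmon (B : {set T}) : B \subset V -> ell_cl V cmon B = cl B.
Proof.
move=> BV; apply/setP => v; rewrite inE; case: (boolP (v \in V)) => vV /=.
  exact: cmon_le.
by symmetry; apply: contraNF vV => /(subsetP (cl_sub hcl BV)).
Qed.

Lemma cmon_anti : {in V &, forall u v, (cmon u <= cmon v)%MM -> u = v}.
Proof.
move=> u v uV vV.
by rewrite -(ell1 cmon v) cmon_le ?sub1set // (cl_set1 hcl) // => /set1P.
Qed.

Lemma cmon_neq0 v : v \in V -> cmon v != 0%MM.
Proof.
move=> vV; apply/eqP => z; have : v \in cl set0.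
  by rewrite -cmon_le ?sub0set // z ell0 lepm_refl.
by rewrite (cl_set0 hcl) inE.
Qed.

Definition cgens := [seq cmon v | v <- enum V].

Lemma cgens_min : min_gens cgens.
Proof.
split.
  rewrite map_inj_in_uniq ?enum_uniq // => u v; rewrite !mem_enum => uV vV e.
  by apply: cmon_anti => //; rewrite e lepm_refl.
move=> _ _ /mapP[u uV ->] /mapP[v vV ->]; rewrite !mem_enum in uV vV.
by move/cmon_anti => ->.
Qed.

Lemma cgens_lattice : iso_lcm_lattice (clattice hcl) cgens.
Proof.
exists (fun x => ell cmon (cset x)); split=> [x y|m].
  rewrite -(ell_cl_le (V := V)) ?cset_subV // ell_cl_cmon ?cset_subV // cl_cset.
  by [].
rewrite (in_lcm_latticeP (V := V) (g := cmon)) //; split=> [[A AV ->]|[x <-]].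
  exists (cmk hcl A); rewrite cset_cmk // -ell_cl_cmon //.
  exact: ell_ell_cl.
by exists (cset x); rewrite ?cset_subV.
Qed.

(** An upper bound suffices, since maximality demands a strictly larger projective dimension. *)
Lemma clattice_pdim p : (0 < p)%N ->
  (forall m : {set T}, m \subset V -> cl m = m -> gam_exact K cl p m) ->
  exists2 p', (p' <= p)%N & pdimQ K (clattice hcl) p'.
Proof.
move=> p0 hv; have [I0 IB IM] := mon_ideal_closed cgens K.
have [M qM] := quotient_exists I0 IB IM; have [pi [spi kpi]] := qM.
have res : has_proj_resolution M p.
  apply: (truncated_resolution cmon_neq0 cmon_anti spi) => //.
    move=> r; rewrite kpi; apply: mon_idealP => //; first by case: cgens_min.
    by move=> u v uV vV e; apply: cmon_anti => //; rewrite e lepm_refl.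
  move=> m mV clm; rewrite ell_cl_cmon // in clm.
  by apply: (eq_gam_exact (V := V) _ mV (hv m mV clm)) => A AV; rewrite ell_cl_cmon.
have [p' [p'p resp' minp']] := ex_least res.
exists p' => //; exists #|{set T}|, cgens, M; split=> //; first exact: cgens_min.
exact: cgens_lattice.
Qed.

End Realization.

(** * Atoms of a lattice as generators of a representing ideal *)

Section FromLattice.
Variables (d : Order.disp_t) (L : finTBLatticeType d) (n : nat) (G : seq 'X_{1..n}).
Variable f : L -> 'X_{1..n}.
Hypothesis minG : min_gens G.
Hypothesis f_le : forall x y, (f x <= f y)%MM = (x <= y)%O.
Hypothesis f_im : forall m, in_lcm_lattice G m <-> exists x, f x = m.
Hypothesis atoms0 : atoms L != set0.

Lemma f_inj : injective f.
Proof. by move=> x y e; apply: le_anti; rewrite -!f_le e lepm_refl. Qed.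

Lemma f_bot : f \bot%O = 0%MM.
Proof.
have [x fx] : exists x, f x = 0%MM by apply/f_im; exists [::].
by apply: lem_anti; [rewrite -fx f_le le0x | apply/mnm_lepP => i; rewrite mnm0E].
Qed.

Lemma atomP a : a \in atoms L ->
  a != \bot%O /\ forall x, (x <= a)%O -> x != \bot%O -> x = a.
Proof.
rewrite inE => /andP[a0 /forallP ha]; split=> // x xa x0.
by apply/eqP; apply: contraNT x0 => nx; apply: (implyP (ha x)); rewrite lt_neqAle nx.
Qed.

Lemma gens_atoms : G =i [seq f a | a <- enum (atoms L)].
Proof.
have [uG antiG] := minG; move=> h; apply/idP/mapP => [hG|[a]].
  have [x fx] : exists x, f x = h.
    apply/f_im; exists [:: h]; split=> [k|]; first by rewrite inE => /eqP->.
    by rewrite /mlcms /= mlcm0.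
  (* If the monomial 1 were a generator it would be the only one, and the lcm lattice would be a
     point without atoms. *)
  have x0 : x != \bot%O.
    have [a aat] := set0Pn _ atoms0.
    apply: contraTneq aat => ex; rewrite inE negb_and negbK; apply/orP; left.
    have [s [sG sa]] : in_lcm_lattice G (f a) by apply/f_im; exists a.
    apply/eqP/f_inj; rewrite sa f_bot; apply: lem_anti; last first.
      by apply/mnm_lepP => i; rewrite mnm0E.
    rewrite mlcms_le; apply/allP => k /sG kG.
    have h0 : h = 0%MM by rewrite -fx ex f_bot.
    by rewrite -(antiG h k) // h0 ?lepm_refl //; apply/mnm_lepP => i; rewrite mnm0E.
  exists x; rewrite ?mem_enum ?fx // inE x0; apply/forallP => y; apply/implyP => yx.
  have [s [sG sy]] : in_lcm_lattice G (f y) by apply/f_im; exists y.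
  case: s => [|k s] in sG sy; first by apply/eqP/f_inj; rewrite sy f_bot.
  have ky : (k <= f y)%MM.
    by have := lepm_refl (f y); rewrite {1}sy mlcms_le => /andP[].
  have kh : k = h.
    apply: antiG => //; first by apply: sG; rewrite inE eqxx.
    by apply: lepm_trans ky _; rewrite -fx f_le ltW.
  have xy : (x <= y)%O by rewrite -f_le fx -kh.
  by have := lt_le_trans yx xy; rewrite ltxx.
rewrite mem_enum => aat ->; have [a0 ha] := atomP aat.
have [s [sG sa]] : in_lcm_lattice G (f a) by apply/f_im; exists a.
case: s => [|k s] in sG sa; first by case/eqP: a0; apply: f_inj; rewrite f_bot.
have kG : k \in G by apply: sG; rewrite inE eqxx.
have ka : (k <= f a)%MM.
  by have := lepm_refl (f a); rewrite {1}sa mlcms_le => /andP[].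
have [x fx] : exists x, f x = k.
  apply/f_im; exists [:: k]; split=> [j|]; first by rewrite inE => /eqP->.
  by rewrite /mlcms /= mlcm0.
have [x0|x0] := eqVneq x \bot%O; last by rewrite -(ha x) // ?fx // -f_le fx.
have k0 : k = 0%MM by rewrite -fx x0 f_bot.
case/eqP: a0; apply: f_inj; rewrite sa f_bot; apply: lem_anti; last first.
  by apply/mnm_lepP => i; rewrite mnm0E.
rewrite mlcms_le; apply/allP => j /sG jG.
by rewrite -(antiG k j) // k0 ?lepm_refl //; apply/mnm_lepP => i; rewrite mnm0E.
Qed.

Lemma f_atom_neq0 v : v \in atoms L -> f v != 0%MM.
Proof. by case/atomP => v0 _; rewrite -f_bot (inj_eq f_inj). Qed.

Lemma f_atom_anti : {in atoms L &, forall u v, (f u <= f v)%MM -> u = v}.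
Proof.
by move=> u v /atomP[u0 _] /atomP[_ hv]; rewrite f_le => uv; apply: hv.
Qed.

Lemma f_set_join (A : {set L}) : A \subset atoms L -> f (set_join A) = ell f A.
Proof.
move=> AV; apply: lem_anti; last first.
  by rewrite ell_le; apply/forall_inP => a aA; rewrite f_le le_set_join.
have [y fy] : exists y, f y = ell f A.
  by apply/f_im/(in_lcm_latticeP gens_atoms); exists A.
by rewrite -fy f_le; apply/set_joinP => a aA; rewrite -f_le fy lem_g.
Qed.

Lemma ell_cl_atoms (A : {set L}) : A \subset atoms L ->
  ell_cl (atoms L) f A = [set a in atoms L | (a <= set_join A)%O].
Proof. by move=> AV; apply/setP => a; rewrite !inE -f_set_join // f_le. Qed.

End FromLattice.

(** * The Scarf complex of a maximal lattice *)

Lemma cl_add_closure (T : finType) (V : {set T}) cl (A0 : {set T}) :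
  closure_op V cl -> min_nonface V cl A0 -> closure_op V (cl_add cl A0).
Proof.
move=> hcl [A0V nA0 hA0].
have sub_add (A : {set T}) : A \subset V -> cl_add cl A0 A \subset cl A.
  by rewrite /cl_add; case: (A =P A0) => // ->; apply: cl_ext.
split=> [A AV|A AV|A B AV BV||v vV].
- by rewrite /cl_add; case: (A =P A0) => [->//|_]; apply: (cl_ext hcl).
- exact: subset_trans (sub_add A AV) (cl_sub hcl AV).
(* For B = A0, a set properly contained in [A0] is closed by minimality. *)
- rewrite {1 3}/cl_add; case: (B =P A0) => [_ AA0|_ AB]; last first.
    exact: subset_trans (sub_add A AV) (cl_min hcl AV BV AB).
  rewrite /cl_add; case: eqP => // /eqP nA.
  by rewrite hA0 // properEneq nA.
- rewrite /cl_add; case: eqP => [e|_]; last exact: (cl_set0 hcl).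
  by rewrite -e (cl_set0 hcl) eqxx in nA0.
- rewrite /cl_add; case: eqP => [e|_]; last exact: (cl_set1 hcl).
  by rewrite -e (cl_set1 hcl) ?eqxx in nA0.
Qed.

(** * The lattice enlarged by a minimal nonface *)

Section Extension.
Variables (d : Order.disp_t) (L : finTBLatticeType d).
Hypothesis atomL : atomistic L.
Local Notation V := (atoms L).

Definition below (y : L) : {set L} := [set a in V | (a <= y)%O].

Lemma below_sub y : below y \subset V.
Proof. by apply/subsetP => a; rewrite inE => /andP[]. Qed.

Variable cl : {set L} -> {set L}.
Hypothesis hcl : closure_op V cl.
Hypothesis clE : forall A : {set L}, A \subset V -> cl A = below (set_join A).

Lemma set_join_below y : set_join (below y) = y.
Proof.
apply/le_anti/andP; split; first by apply/set_joinP => a; rewrite inE => /andP[].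
have [A [AV yA]] := atomL y; rewrite {1}yA; apply/set_join_mono/subsetP => a aA.
by rewrite inE (subsetP AV) //= yA le_set_join.
Qed.

Lemma cl_below y : cl (below y) = below y.
Proof. by rewrite clE ?below_sub // set_join_below. Qed.

Lemma set_join_cl (A : {set L}) : A \subset V -> set_join (cl A) = set_join A.
Proof. by move=> AV; rewrite clE // set_join_below. Qed.

Lemma mem_scarf_complex (F : {set L}) : (F \in scarf_complex L) = face V cl F.
Proof.
apply/imsetP/idP => [[x]|fF].
  rewrite inE -/(below x) => /eqP/eqP/cards1P[A eA] ->.
  have FA : below x = A.
    by apply/set1P; rewrite -eA inE below_sub set_join_below eqxx.
  rewrite /face below_sub; apply/forallP => B; apply/implyP => BF.
  have BV := subset_trans BF (below_sub x).
  rewrite eqEsubset (cl_ext hcl) // andbT; apply/subsetP => w wB; apply: contraT => nwB.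
  have wF : w \in below x.
    by rewrite -cl_below; apply: (subsetP (cl_mono hcl BF (below_sub x))).
  have D_V : below x :\ w \subset V := subset_trans (subsetDl _ _) (below_sub x).
  have eD : set_join (below x :\ w) = x.
    apply/le_anti/andP; split.
      by rewrite -{2}(set_join_below x) set_join_mono ?subsetDl.
    rewrite -{1}(set_join_below x); apply/set_joinP => a aF.
    have [->|aw] := eqVneq a w; last by apply: le_set_join; rewrite in_setD1 aw.
    apply: le_trans (_ : set_join B <= _)%O; last first.
      by apply: set_join_mono; rewrite subsetD1 BF.
    by move: wB; rewrite clE // inE => /andP[].
  have /set1P : below x :\ w \in [set A] by rewrite -eA inE D_V eD eqxx.
  by rewrite -FA => /setP/(_ w); rewrite wF !inE eqxx.
have FV := face_subV fF; exists (set_join F); last first.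
  by rewrite -/(below _) -clE // (face_cl fF).
rewrite inE /scarf_element (_ : [set _ | _] = [set F]) ?cards1 //.
apply/setP => A; rewrite !inE; apply/andP/eqP => [[AV /eqP eA]|->]; last first.
  by rewrite FV eqxx.
have clA : cl A = F by rewrite clE // eA -clE // (face_cl fF).
rewrite -clA; symmetry; apply/face_cl/(face_sub fF).
by rewrite -clA (cl_ext hcl).
Qed.

Variable A0 : {set L}.
Hypothesis mA0 : min_nonface V cl A0.
Let hcl' := cl_add_closure hcl mA0.

Lemma cl_add_below y : cl_add cl A0 (below y) = below y.
Proof.
rewrite /cl_add; case: eqP => [e|_]; last exact: cl_below.
by case: mA0 => _ /eqP[]; rewrite -e cl_below.
Qed.

Lemma cl_add_sub (A : {set L}) : A \subset V -> cl_add cl A0 A \subset cl A.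
Proof.
by rewrite /cl_add; case: (A =P A0) => // -> A0V; apply: (cl_ext hcl).
Qed.

Lemma set_join_cl_add (A : {set L}) : A \subset V ->
  set_join (cl_add cl A0 A) = set_join A.
Proof.
move=> AV; apply/le_anti/andP; split.
  by rewrite -(set_join_cl AV) set_join_mono ?cl_add_sub.
by apply: set_join_mono; apply: (cl_ext hcl').
Qed.

(** A set of atoms and its closure under [cl_add] have the same join in L, so taking joins commutes
    with the join of the enlarged lattice. *)
Lemma extension_join_surjection :
  exists h : clattice hcl' -> L, join_surjection h.
Proof.
exists (fun x => set_join (cset x)); split=> [y|x y].
  exists (cmk hcl' (below y)).
  by rewrite cset_cmk ?below_sub // cl_add_below set_join_below.
have UV : cset x :|: cset y \subset V by rewrite subUset !cset_subV.
by rewrite -set_joinU -(set_join_cl_add UV) -(cset_cmk hcl' UV).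
Qed.

(** An arbitrary isomorphism followed by the embedding of L would be an injective self-map of a
    finite lattice, hence onto, but the embedding misses [A0]. *)
Lemma extension_not_iso : ~ lattice_iso (clattice hcl') L.
Proof.
case=> h [/bij_inj h_inj _].
pose k y : clattice hcl' := cmk hcl' (below y).
have kE y : cset (k y) = below y by rewrite cset_cmk ?below_sub // cl_add_below.
have k_inj : injective k.
  move=> y z /(congr1 (@cset _ _ _ hcl')); rewrite !kE => e.
  by rewrite -(set_join_below y) e set_join_below.
have [k' _ kk'] := injF_bij (inj_comp k_inj h_inj).
have [A0V nA0 _] := mA0.
have := kk' (cmk hcl' A0) => /(congr1 (@cset _ _ _ hcl')).
rewrite [LHS](kE (h _)) [RHS]cset_cmk // /cl_add eqxx => e.
by case/eqP: nA0; rewrite -e cl_below.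
Qed.

End Extension.

Theorem theorem4p3 (K : fieldType) (d : Order.disp_t)
    (L : finTBLatticeType d) (k p : nat)
    (hmax : maximal_lattice K L) (hk : #|atoms L| = k) (hk1 : (1 <= k)%N)
    (hp : pdimQ K L p) :
  stoss_complex K (p%:Z - 1) (atoms L) (scarf_complex L).
Proof.
have [atomL maxL] := hmax.
have V0 : atoms L != set0 by rewrite -card_gt0 hk.
have [a aV] := set0Pn _ V0.
have [n [G [M [minG [f [f_le f_im]] [pi [spi kpi]] [res minres]]]]] := hp.
have Gf := gens_atoms minG f_le f_im V0.
have g0 := f_atom_neq0 f_le f_im; have ganti := f_atom_anti f_le.
pose cl := ell_cl (atoms L) f.
have hcl : closure_op (atoms L) cl := ell_closure g0 ganti.
have clE (A : {set L}) : A \subset atoms L -> cl A = below (set_join A).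
  exact: (ell_cl_atoms minG f_le f_im V0).
have kpi' r : pi r = 0 <->
    exists c : L -> {mpoly K[n]}, r = \sum_(v in atoms L) c v * 'X_[f v].
  rewrite kpi; apply: (mon_idealP Gf); first by case: minG.
  by move=> u v _ _; apply: (f_inj f_le).
have H1 := gam_exact_of_resolution g0 ganti spi kpi' res.
have not0 := not_gam_exact0 (K := K) hcl aV.
have cla : cl [set a] = [set a] by apply: (cl_set1 hcl).
have aV' : [set a] \subset atoms L by rewrite sub1set.
have p0 : (0 < p)%N.
  by rewrite lt0n; apply/eqP => p0; apply/not0/(H1 _ aV' cla); rewrite p0.
have H2 :
    exists m : {set L}, [/\ m \subset atoms L, cl m = m & ~ gam_exact K cl p.-1 m].
  apply: NNPP => h.
  have hv (m : {set L}) : m \subset atoms L -> cl m = m -> gam_exact K cl p.-1 m.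
    by move=> mV clm; apply: NNPP => nv; apply: h; exists m.
  (* Truncation requires a positive degree, so p = 1 is settled by the nonzero Tor_1 at an atom. *)
  case: (posnP p.-1) => [e|p1]; first by apply: not0; have := hv _ aV' cla; rewrite e.
  apply: (minres p.-1); first by rewrite ltn_predL.
  exact: (truncated_resolution g0 ganti spi kpi' p1 hv).
have H3 (A0 : {set L}) : min_nonface (atoms L) cl A0 ->
    ~ (forall m : {set L}, m \subset atoms L -> cl_add cl A0 m = m ->
       gam_exact K (cl_add cl A0) p m).
  move=> mA0 /(clattice_pdim (cl_add_closure hcl mA0) p0)[p' p'p hp'].
  have := maxL _ _ (@clattice_atomistic _ _ _ _)
    (@extension_not_iso _ _ atomL _ hcl clE _ mA0) (card_atoms_clattice _)
    (@extension_join_surjection _ _ atomL _ hcl clE _ mA0) p p' hp hp'.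
  by rewrite ltnNge p'p.
have scE := mem_scarf_complex atomL hcl clE.
split.
- split=> [|F|F B]; rewrite !scE; [exact: face0 | exact: face_subV | exact: face_sub].
- have [A fA szA] := face_card_eq hcl p0 H1 H2 H3.
  rewrite /sc_dim (_ : (\max_(F in scarf_complex L) #|F|)%N = p) //.
  apply/eqP; rewrite eqn_leq; apply/andP; split.
    by apply/bigmax_leqP => F; rewrite scE => fF; exact: (face_card H1 fF).
  by rewrite -szA; apply: (leq_bigmax_cond (F := fun F : {set L} => #|F|)); rewrite scE.
- move=> F FV szF; rewrite scE; apply: (skeleton_face H1 H3 FV).
  by move: szF; rewrite Num.Theory.lerBrDr -PoszD lez_nat addn1.
move=> m c sc zc.
have [||b [sb bb]] := face_acyclic hcl V0 H1 H3 (n := m) (c := c).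
- move=> F; apply: contraNeq => nz; have [FD szF] := sc F nz.
  by rewrite -scE FD szF eqxx.
- exact: zc.
exists b; split=> // F nz; have := supp_mem sb nz; rewrite -scE => /andP[-> /eqP ->].
by [].
Qed.
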